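(* Fix $k\ge1$ and an odd prime $p$. Let $\delta>0$ and let $\omega_1,\omega_2\colon\mathbb{R}^+\to\mathbb{R}^+$ be arbitrary functions (possibly depending on $\delta$). Let $G=\mathbb{F}_p^n$, let $f\colon G^k\to[0,1]$, and let $\mathfrak{B}^{(0)}$ be a $k$-symmetrized quadratic factor of complexity $(d_1^{(0)},d_2^{(0)},d_3^{(0)})$. Then there is a $k$-symmetrized quadratic factor $\mathfrak{B}$ refining $\mathfrak{B}^{(0)}$, of complexity $(d_1,d_2,d_3)$, and a decomposition $f=f_{\mathrm{str}}+f_{\mathrm{sml}}+f_{\mathrm{psr}}$ such that: (1) $f_{\mathrm{str}}=\mathbb{E}[f\mid\mathfrak{B}]$; (2) $\|f_{\mathrm{sml}}\|_2\le\delta$; (3) $\|f_{\mathrm{psr}}\|_{U^3(G^k)}\le 1/\omega_2(d_1+d_2+d_3)$; (4) $f_{\mathrm{str}}$ and $f_{\mathrm{str}}+f_{\mathrm{sml}}$ take values in $[0,1]$ and $f_{\mathrm{psr}},f_{\mathrm{sml}}$ take values in $[-1,1]$; (5) $d_1,d_2,d_3\le C(p,k,\delta,\omega_1,\omega_2,d_1^{(0)},d_2^{(0)},d_3^{(0)})$ for a fixed function $C$ (independent of $n$ and $f$); (6) the rank of $\mathfrak{B}$ is at least $\omega_1(d_1+d_2+d_3)$.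
   Context: Identify $G^k=(\mathbb{F}_p^n)^k$ with the $k\times n$ matrices $X$ over $\mathbb{F}_p$ whose rows are the $k$ components. $\mathcal{S}_k$ (resp. $\mathcal{S}_k'$) is the set of symmetric (resp. skew-symmetric) $k\times k$ matrices over $\mathbb{F}_p$. A $k$-symmetrized quadratic factor $\mathfrak{B}$ is given by a list $(r_1,\ldots,r_{d_1})$ of vectors in $\mathbb{F}_p^n$, a list $(M_1,\ldots,M_{d_2})$ of symmetric $n\times n$ matrices over $\mathbb{F}_p$, and a list $(N_1,\ldots,N_{d_3})$ of skew-symmetric $n\times n$ matrices over $\mathbb{F}_p$; its complexity is $(d_1,d_2,d_3)$. It has rank at least $r$ if $r_1,\ldots,r_{d_1}$ are linearly independent and every nontrivial linear combination $\sum_i a_iM_i+\sum_j b_jN_j$ has rank at least $r$. It defines $\mathsf{B}\colon G^k\to(\mathbb{F}_p^k)^{d_1}\times\mathcal{S}_k^{d_2}\times(\mathcal{S}_k')^{d_3}$, $\mathsf{B}(X)=((Xr_i)_{i},(XM_iX^\intercal)_{i},(XN_iX^\intercal)_{i})$. Its $\sigma$-algebra is the one generated by the fibers of $\mathsf{B}$; $\mathfrak{B}'$ refines $\mathfrak{B}$ if the $\sigma$-algebra of $\mathfrak{B}'$ refines that of $\mathfrak{B}$. $\mathbb{E}[f\mid\mathfrak{B}](X)$ is the average of $f$ over the fiber $\mathsf{B}^{-1}(\mathsf{B}(X))$. $\|g\|_2=(\mathbb{E}_{X\in G^k}|g(X)|^2)^{1/2}$ with uniform averages, and $\|g\|_{U^3(G^k)}=\big(\mathbb{E}_{x,h_1,h_2,h_3\in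 G^k}\prod_{\omega\in\{0,1\}^3}\mathcal{C}^{|\omega|}g(x+\omega_1h_1+\omega_2h_2+\omega_3h_3)\big)^{1/8}$ with $\mathcal{C}$ complex conjugation. *)

(* Defs.v *)
From HB Require Import structures.
From mathcomp Require Import all_boot all_order all_algebra.
From mathcomp Require Import complex.
From mathcomp Require Import boolp classical_sets reals measurable_structure.

Set Implicit Arguments.
Unset Strict Implicit.
Unset Printing Implicit Defensive.

Import Order.TTheory GRing.Theory Num.Theory.
Local Open Scope ring_scope.
Local Open Scope complex_scope.
Local Open Scope classical_set_scope.

(* Used only for prime p, where 'F_p is the field with p elements. *)
Definition symm (p m : nat) := {A : 'M['F_p]_m | A \is symmetricmx}.
Definition skew (p m : nat) := {A : 'M['F_p]_m | A \is skewmx}.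

Lemma symm_congr_proof (p k n : nat) (X : 'M['F_p]_(k, n)) (M : symm p n) :
  X *m val M *m X^T \is symmetricmx.
Proof.
apply/is_hermitianmxP; rewrite expr0 scale1r map_mx_id //.
have /is_hermitianmxP := valP M; rewrite expr0 scale1r map_mx_id // => eM.
by rewrite !trmx_mul trmxK -eM mulmxA.
Qed.

Lemma skew_congr_proof (p k n : nat) (X : 'M['F_p]_(k, n)) (N : skew p n) :
  X *m val N *m X^T \is skewmx.
Proof.
apply/is_hermitianmxP; rewrite expr1 scaleN1r map_mx_id //.
have /is_hermitianmxP := valP N; rewrite expr1 scaleN1r map_mx_id // => eN.
by rewrite !trmx_mul trmxK {1}eN mulmxN mulNmx mulmxA.
Qed.

Definition symm_congr (p k n : nat) (X : 'M['F_p]_(k, n)) (M : symm p n) :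
  symm p k := Sub (X *m val M *m X^T) (symm_congr_proof X M).

Definition skew_congr (p k n : nat) (X : 'M['F_p]_(k, n)) (N : skew p n) :
  skew p k := Sub (X *m val N *m X^T) (skew_congr_proof X N).

(* The number k of components only enters through [factor_map]. *)
Record quad_factor (p n d1 d2 d3 : nat) := QuadFactor {
  linear_part : d1.-tuple 'cV['F_p]_n;
  symm_part : d2.-tuple (symm p n);
  skew_part : d3.-tuple (skew p n) }.

Definition factor_rank_ge (R : realType) (p n d1 d2 d3 : nat)
    (B : quad_factor p n d1 d2 d3) (r : R) : Prop :=
  free (linear_part B) /\
  forall (a : 'I_d2 -> 'F_p) (b : 'I_d3 -> 'F_p),
    ~ ((forall i, a i = 0) /\ (forall j, b j = 0)) ->
    r <= (\rank (\sum_(i < d2) a i *: val (tnth (symm_part B) i)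
                 + \sum_(j < d3) b j *: val (tnth (skew_part B) j))%R)%:R.

Definition factor_map (k p n d1 d2 d3 : nat) (B : quad_factor p n d1 d2 d3)
    (X : 'M['F_p]_(k, n)) :
    d1.-tuple 'cV['F_p]_k * d2.-tuple (symm p k) * d3.-tuple (skew p k) :=
  ([tuple X *m tnth (linear_part B) i | i < d1],
   [tuple symm_congr X (tnth (symm_part B) i) | i < d2],
   [tuple skew_congr X (tnth (skew_part B) j) | j < d3]).

Arguments factor_map k {p n d1 d2 d3} B X.

Definition factor_sigma_algebra (k p n d1 d2 d3 : nat)
    (B : quad_factor p n d1 d2 d3) : set (set 'M['F_p]_(k, n)) :=
  <<s [set (factor_map k B) @^-1` [set y] | y in [set: _]] >>.

Arguments factor_sigma_algebra k {p n d1 d2 d3} B.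

Definition refines (k p n d1 d2 d3 e1 e2 e3 : nat)
    (B' : quad_factor p n d1 d2 d3) (B : quad_factor p n e1 e2 e3) : Prop :=
  factor_sigma_algebra k B `<=` factor_sigma_algebra k B'.

Arguments refines k {p n d1 d2 d3 e1 e2 e3} B' B.

Definition cond_exp (R : realType) (k p n d1 d2 d3 : nat)
    (f : 'M['F_p]_(k, n) -> R) (B : quad_factor p n d1 d2 d3)
    (X : 'M['F_p]_(k, n)) : R :=
  (\sum_(Y | factor_map k B Y == factor_map k B X) f Y)
  / #|[pred Y | factor_map k B Y == factor_map k B X]|%:R.

Definition average (F : numFieldType) (T : finType) (g : T -> F) : F :=
  (\sum_x g x) / #|T|%:R.

(* The norms of complex-valued functions below take values in [R[i]]; they are
   roots of nonnegative real elements of [R[i]], hence nonnegative reals. *)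
Definition L2_norm (R : realType) (T : finType) (g : T -> R[i]) : R[i] :=
  sqrtC (average (fun x => `|g x| ^+ 2)).

Definition U3_norm (R : realType) (A : finZmodType) (g : A -> R[i]) : R[i] :=
  8.-root (average (fun x => average (fun h1 => average (fun h2 =>
    average (fun h3 =>
      \prod_(w1 : bool) \prod_(w2 : bool) \prod_(w3 : bool)
        iter (w1 + w2 + w3)%N Num.conj
          (g (x + h1 *+ w1 + h2 *+ w2 + h3 *+ w3))))))).

(* Main.v *)
(* Write [W(h, xi) = |E_x f(x + h) conj(f(x)) e(- xi . x)|^2].  If the U^3 norm
   of [f] is large then so is the sum of [W^2], and [W], being its own symplectic
   Fourier transform, has a level set with many additive triples.  The
   Balog-Szemeredi-Gowers argument and the torsion case of Freiman's theorem
   concentrate the mass of [W] on a subgroup of size [O(p^N)], hence on the graph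
   of a linear map [T]; a Cauchy-Schwarz argument shows that [T] is symmetric up
   to bounded rank.  Multiplying [f] by the corresponding quadratic phase makes
   its U^2 norm large, so [f] correlates with a quadratic phase.  Such a phase is
   measurable with respect to a factor of bounded complexity, and adding this
   factor increases the energy of [E[f | B]]; the decomposition follows by the
   usual two-level energy increment, in which low-rank combinations of the
   matrices of a factor are traded for boundedly many vectors. *)
Require Import Defs.
From HB Require Import structures.
From mathcomp Require Import all_boot all_order all_algebra archimedean.
From mathcomp Require Import complex ring lra zify.
From mathcomp Require Import boolp classical_sets reals measurable_structure.

Set Implicit Arguments.
Unset Strict Implicit.
Unset Printing Implicit Defensive.

Import boot.fintype boot.finset.
Import Order.TTheory GRing.Theory Num.Theory.
Local Open Scope ring_scope.
Local Open Scope complex_scope.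

(** The analysis takes place on [F_p^N] with [N = k n], a matrix [X] being flattened by [mxvec]. The
    quadratic phase found there has an [N x N] matrix; cut into [n x n] blocks, its block [Q] at
    [(i, j)] contributes the entry [(i, j)] of [X Q X^T]. An off-diagonal block need not be
    symmetric even when the large matrix is, so each block is split into a symmetric and a skew
    half. This is where skew matrices enter a factor, and one of the places where [p] must be odd.
    Self-duality of [W] is used twice: it evaluates the weighted count of additive triples, and it
    shows that no translate of a subgroup carries more [W]-mass than the subgroup itself. Hence a
    large piece found on a coset can always be moved back to the subgroup. Up to the correlation
    with a quadratic phase, no constant depends on [N]. At the level of factors the functions
    [omega1] and [omega2] are arbitrary, not monotone, so thresholds are handled by maxima over the
    finitely many complexities below a known bound. *)

Local Notation conj := (@Num.conj _).
(* The library has no [finZmodType] instance on products. *)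
HB.instance Definition _ (A B : finZmodType) := GRing.Zmodule.on (A * B)%type.

(** * Counting and averaging over finite sets *)

Section Counting.
Variable R : archiRealFieldType.

Lemma sum_le_card (T : finType) (Q : {set T}) (F : T -> R) (b : R) :
  (forall t, t \in Q -> F t <= b) -> \sum_(t in Q) F t <= #|Q|%:R * b.
Proof.
by move=> h; rewrite mulr_natl -sumr_const; apply: ler_sum.
Qed.

Lemma sum_ge_card (T : finType) (Q : {set T}) (F : T -> R) (b : R) :
  (forall t, t \in Q -> b <= F t) -> #|Q|%:R * b <= \sum_(t in Q) F t.
Proof.
by move=> h; rewrite mulr_natl -sumr_const; apply: ler_sum.
Qed.

Lemma natr_card_sum (T : finType) (Q : {set T}) (P : pred T) :
  #|[set t in Q | P t]|%:R = \sum_(t in Q) (P t)%:R :> R.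
Proof.
rewrite -sum1_card natr_sum big_mkcond [RHS]big_mkcond /=.
by apply: eq_bigr => t _; rewrite inE; case: (t \in Q); case: (P t).
Qed.

(** Distinct fibres are disjoint. This turns many representations of each element of [Y] into an
    upper bound for [#|Y|]. *)
Lemma card_fibers_le (T U : finType) (f : T -> U) (Y : {set U}) (Q : {set T})
    (c : R) :
  (forall y, y \in Y -> c <= #|[set t in Q | f t == y]|%:R) ->
  #|Y|%:R * c <= #|Q|%:R.
Proof.
move=> h; apply: le_trans (sum_ge_card h) _.
under eq_bigr do rewrite natr_card_sum.
rewrite exchange_big /= -[in leRHS]sum1_card natr_sum.
apply: ler_sum => t _; rewrite -natr_sum ler_nat.
rewrite (bigID (pred1 (f t))) /= [X in (_ + X)%N]big1 => [|y /andP[_ /negPf]].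
  rewrite addn0 (eq_bigr (fun=> 1%N)) => [|y /andP[_ /eqP ->]]; last first.
    by rewrite eqxx.
  rewrite sum1_card -[leqRHS](card1 (f t)).
  by apply: subset_leq_card; apply/subsetP => y; rewrite inE => /andP[].
by rewrite eq_sym => ->.
Qed.

Lemma exists_ge_of_sum (T : finType) (Q : {set T}) (F : T -> R) (b : R) :
  (0 < #|Q|)%N -> #|Q|%:R * b <= \sum_(t in Q) F t ->
  exists2 t, t \in Q & b <= F t.
Proof.
move=> Q0 h; case: (boolP [exists t in Q, b <= F t]) => [/exists_inP[t]|].
  by exists t.
move=> /exists_inPn hn; exfalso; move: h; apply/negP; rewrite -ltNge.
rewrite mulr_natl -sumr_const; apply: ltr_sum => [|t tQ].
  by apply/hasP; case/card_gt0P: Q0 => t tQ; exists t; rewrite ?mem_index_enum.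
by rewrite ltNge; apply: hn.
Qed.

End Counting.

(** * The Balog-Szemeredi-Gowers argument *)

Section Differences.
Variables (R : archiRealFieldType) (Z : finZmodType).
Implicit Types (A X S Y : {set Z}) (d x y : Z).

Definition diff_reps A d := [set x in A | x - d \in A].

Definition sums A Y := [set x + y | x in A, y in Y].

Lemma sum_diff_reps A : \sum_d #|diff_reps A d|%:R = #|A|%:R ^+ 2 :> R.
Proof.
under eq_bigr do rewrite natr_card_sum.
rewrite exchange_big /= expr2 mulr_natl -sumr_const; apply: eq_bigr => x _.
rewrite (reindex_inj (inj_comp (addrI x) (@oppr_inj Z))) /=.
under eq_bigr do rewrite opprB addrC subrK.
by rewrite -natr_sum -big_mkcond /= sum1_card.
Qed.

Lemma diff_repsN A d : #|diff_reps A (- d)| = #|diff_reps A d|.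
Proof.
rewrite -(card_imset (diff_reps A d) (addIr (- d))); apply: eq_card => x.
rewrite [LHS]inE opprK; apply/andP/imsetP => [[xA xdA]|[y]].
  by exists (x + d); rewrite ?addrK // inE xdA addrK.
by rewrite inE => /andP[yA ydA] ->; rewrite ydA subrK.
Qed.

Definition popular A (c : R) := [set d | c <= #|diff_reps A d|%:R].

Lemma popularN A c d : d \in popular A c -> - d \in popular A c.
Proof. by rewrite !inE diff_repsN. Qed.

Lemma card_popular_le A c : #|popular A c|%:R * c <= #|A|%:R ^+ 2.
Proof.
rewrite -sum_diff_reps (bigID (mem (popular A c))) /=.
apply: ler_wpDr; first exact: sumr_ge0.
by apply: sum_ge_card => d; rewrite inE.
Qed.

(* Dependent random choice: on average over [b], the pairs of points of the
   neighbourhood [{x in A | x + b in A}] with an unpopular difference are few,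
   since each such pair lies in few neighbourhoods. *)
Lemma exists_good_neighbourhood A (delta : R) :
  0 < delta -> (0 < #|A|)%N ->
  delta * #|A|%:R ^+ 2 <= \sum_(b in A) #|[set x in A | x + b \in A]|%:R ->
  exists N : {set Z}, [/\ N \subset A, delta / 2 * #|A|%:R <= #|N|%:R &
    8 * \sum_(x in N) \sum_(y in N)
      (x - y \notin popular A (delta ^+ 2 / 16 * #|A|%:R))%:R
    <= #|N|%:R ^+ 2 :> R].
Proof.
move=> d0 A0 hsum; set P := popular _ _; set a : R := #|A|%:R.
have a0 : 0 < a by rewrite ltr0n.
pose N b := [set x in A | x + b \in A].
pose bad b : R := \sum_(x in N b) \sum_(y in N b) (x - y \notin P)%:R.
(* Each [b] with [x] and [y] in [N b] gives the representation [(x + b) - (y + b)] of [x - y], so an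
   unpopular pair is counted for fewer than [delta^2 a / 16] values of [b]. *)
have hbad : \sum_(b in A) bad b <= a * (a * (delta ^+ 2 / 16 * a)).
  rewrite /bad (eq_bigr (fun b => \sum_(x in A) \sum_(y in A)
    ((x - y \notin P) && ((x + b \in A) && (y + b \in A)))%:R)); last first.
    move=> b _; rewrite big_mkcond [RHS]big_mkcond /=; apply: eq_bigr => x _.
    rewrite inE; case: (x \in A) => //=; case: (x + b \in A) => /=; last first.
      by rewrite big1 // => y _; rewrite andbF.
    rewrite big_mkcond [RHS]big_mkcond /=; apply: eq_bigr => y _.
    by rewrite inE; case: (y \in A); case: (y + b \in A); rewrite /= ?andbT ?andbF.
  rewrite exchange_big; apply: sum_le_card => x xA /=.
  rewrite exchange_big; apply: sum_le_card => y yA /=.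
  case: (boolP (x - y \in P)) => /= [_|].
    by rewrite big1 // !mulr_ge0 ?sqr_ge0 ?invr_ge0 ?ler0n // ltW.
  rewrite inE -ltNge => /ltW; apply: le_trans; rewrite -natr_card_sum ler_nat.
  rewrite -(card_imset _ (addrI x)); apply: subset_leq_card.
  apply/subsetP => z /imsetP[b]; rewrite inE => /and3P[bA xbA ybA] ->.
  by rewrite inE xbA opprB addrC addrA subrK.
(* The first moment bounds the second through [(t - delta a)^2 >= 0]. *)
have hN : a * (delta ^+ 2 * a ^+ 2) <= \sum_(b in A) #|N b|%:R ^+ 2.
  have /ler_wpM2l : 0 <= 2 * delta * a by rewrite !mulr_ge0 // ltW.
  move=> /(_ _ _ hsum); rewrite mulr_sumr -/a -/(N _) => h.
  have : \sum_(b in A) (2 * delta * a * #|N b|%:R - delta ^+ 2 * a ^+ 2)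
      <= \sum_(b in A) #|N b|%:R ^+ 2.
    apply: ler_sum => b _; move: #|N b|%:R => t.
    by rewrite -subr_ge0; have := sqr_ge0 (t - delta * a); congr (_ <= _); ring.
  rewrite sumrB sumr_const -[X in _ - X <= _]mulr_natl -/a.
  move: h; rewrite /N; move: (\sum_(b in A) _) => s1.
  by move: (\sum_(b in A) _) => s2; nra.
(* The weight [8] costs half of the second moment. Since [bad b] is nonnegative, one inequality
   yields both the size of [N b] and the scarcity of bad pairs. *)
have [|b bA] := @exists_ge_of_sum R _ A
    (fun b => #|N b|%:R ^+ 2 - 8 * bad b) (delta ^+ 2 / 2 * a ^+ 2) A0.
  rewrite -/a big_split /= sumrN -mulr_sumr; move: hN hbad; rewrite -/a; lra.
have bad0 : 0 <= bad b by apply: sumr_ge0 => x _; apply: sumr_ge0.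
move=> hb; exists (N b); split; first by apply/subsetP => x; rewrite inE => /andP[].
  rewrite -/a -(@ler_pXn2r _ 2) ?nnegrE ?ler0n //; last first.
    by rewrite !mulr_ge0 ?invr_ge0 // ltW.
  have := mulr_ge0 (sqr_ge0 delta) (sqr_ge0 a); move: hb; nra.
rewrite -/(bad b).
have := mulr_ge0 (sqr_ge0 delta) (sqr_ge0 a); move: hb; lra.
Qed.

(** Discard the points of [N] with more than a quarter of [N] as bad partners; at least half of [N]
    remains. Two remaining points [x] and [y] share at least [|N| / 2] good partners [z], and each
    writes [x - y = (x - z) + (z - y)] as a sum of two popular differences, of which there are at
    most [16 |A| / delta^2]. *)
Lemma balog_szemeredi_gowers A (delta : R) :
  0 < delta -> (0 < #|A|)%N ->
  delta * #|A|%:R ^+ 2 <= \sum_(b in A) #|[set x in A | x + b \in A]|%:R ->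
  exists X : {set Z}, [/\ X \subset A, delta / 4 * #|A|%:R <= #|X|%:R &
    #|[set x - y | x in X, y in X]|%:R * (delta ^+ 5 / 1024) <= #|A|%:R :> R].
Proof.
move=> d0 A0 hsum.
have [N [NA Nbig Nbad]] := exists_good_neighbourhood d0 A0 hsum.
set P := popular _ _ in Nbad. set a : R := #|A|%:R in Nbig *.
have a0 : 0 < a by rewrite ltr0n.
have N0 : (0 : R) < #|N|%:R by apply: lt_le_trans Nbig; rewrite mulr_gt0 ?divr_gt0 ?ltr0n.
pose bad x : R := \sum_(y in N) (x - y \notin P)%:R.
pose X := [set x in N | 4 * bad x <= #|N|%:R].
have XN : X \subset N by apply/subsetP => x; rewrite inE => /andP[].
have Xbig : #|N|%:R <= 2 * #|X|%:R :> R.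
  have h1 : #|N :\: X|%:R * (#|N|%:R / 4) <= \sum_(x in N) bad x.
    rewrite (big_setID X) /=; apply: ler_wpDl.
      by apply: sumr_ge0 => x _; apply: sumr_ge0.
    apply: sum_ge_card => x; rewrite !inE negb_and andb_orl.
    by case: (x \in N) => //=; rewrite -ltNge; lra.
  have h2 : #|N|%:R = #|X|%:R + #|N :\: X|%:R :> R.
    by rewrite -natrD -(cardsID X N) (setIidPr XN).
  have h3 : #|N :\: X|%:R * (#|N|%:R / 4) <= #|N|%:R / 8 * #|N|%:R :> R.
    by apply: le_trans h1 _; move: Nbad; rewrite -/(\sum_(x in N) bad x); lra.
  have : #|N :\: X|%:R <= #|N|%:R / 2 :> R.
    rewrite -(ler_pM2r (x := #|N|%:R / 4)); last by rewrite divr_gt0.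
    lra.
  lra.
have PP : #|P|%:R * (delta ^+ 2 / 16) <= a.
  by rewrite -(ler_pM2r a0) -mulrA -expr2; apply: card_popular_le.
exists X; split; first exact: subset_trans XN NA.
  by rewrite -/a; move: Nbig Xbig; lra.
have : #|[set x - y | x in X, y in X]|%:R * (#|N|%:R / 2) <= #|setX P P|%:R :> R.
  apply: (@card_fibers_le R _ _ (fun z => z.1 + z.2)) => _ /imset2P[x y xX yX ->].
  have h : #|[set z in N | (x - z \in P) && (y - z \in P)]|%:R
      = \sum_(z in N) ((x - z \in P) && (y - z \in P))%:R :> R.
    exact: natr_card_sum.
  apply: (@le_trans _ _ #|[set z in N | (x - z \in P) && (y - z \in P)]|%:R).
    have : #|N|%:R <= bad x + bad y + \sum_(z in N)
        ((x - z \in P) && (y - z \in P))%:R :> R.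
      rewrite -big_split -big_split /= -sum1_card natr_sum; apply: ler_sum => z _.
      by case: (x - z \in P); case: (y - z \in P) => /=; lra.
    rewrite -h.
    by move: xX yX; rewrite !inE => /andP[_ hx] /andP[_ hy]; lra.
  have inj : injective (fun z => (x - z, z - y)) by move=> z t [_ /addIr].
  rewrite ler_nat -(card_imset _ inj); apply: subset_leq_card.
  apply/subsetP => t /imsetP[z]; rewrite !inE => /and3P[zN hx hy] ->.
  by rewrite /= hx -(diff_repsN _ (z - y)) opprB hy addrA subrK eqxx.
rewrite cardsX natrM => h.
have := ltW d0; have := ler0n R #|[set x - y | x in X, y in X]|.
have := ler0n R #|P|; move: h PP Nbig a0.
set u : R := #|[set _ | _ in _, _ in _]|%:R; set v : R := #|P|%:R.
set n : R := #|N|%:R => h PP Nbig a0 v0 u0 d0'.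
have h1 : u * (delta / 4 * a) <= v ^+ 2.
  apply: le_trans _ (le_trans h _); last by rewrite expr2.
  by apply: ler_wpM2l => //; lra.
have h2 : (v * (delta ^+ 2 / 16)) ^+ 2 <= a ^+ 2.
  rewrite ler_pXn2r // nnegrE ?(ltW a0) //.
  by rewrite mulr_ge0 // divr_ge0 // ?sqr_ge0 ?ler0n.
have h3 : u * (delta / 4 * a) * (delta ^+ 2 / 16) ^+ 2 <= a ^+ 2.
  apply: le_trans _ h2; rewrite [leRHS]exprMn.
  by apply: ler_wpM2r h1; exact: sqr_ge0.
rewrite -(ler_pM2r a0) -expr2; apply: le_trans _ h3.
by rewrite le_eqVlt; apply/orP; left; apply/eqP; field.
Qed.

End Differences.

(** * Freiman's theorem in a group of bounded exponent *)

Section ApproximateSubgroup.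
Variables (R : archiRealFieldType) (Z : finZmodType).
Implicit Types (A X S Y : {set Z}) (d x y : Z).

Lemma mem_sums A Y x y : x \in A -> y \in Y -> x + y \in sums A Y.
Proof. by move=> xA yY; apply/imset2P; exists x y. Qed.

Lemma zero_popular X K : 0 < K -> #|X|%:R <= K * #|X|%:R :> R ->
  0 \in popular X (#|X|%:R / (2 * K)).
Proof.
move=> K0 h; rewrite inE ler_pdivrMr ?mulr_gt0 //.
have -> : diff_reps X 0 = X by apply/setP => x; rewrite inE subr0 andbb.
by have := ler0n R #|X|; move: h; nra.
Qed.

(** The at most [K |X|] differences that are unpopular account for at most half of the [|X|^2]
    pairs. Averaging the remaining pairs over one of their points gives [a]. *)
Lemma exists_popular_translate X K :
  0 < K -> (0 < #|X|)%N ->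
  #|[set x - y | x in X, y in X]|%:R <= K * #|X|%:R :> R ->
  exists a, #|X|%:R / 2 <= #|[set x in X | x - a \in popular X (#|X|%:R / (2 * K))]|%:R :> R.
Proof.
move=> K0 X0; set S := popular _ _; set XX := [set _ | _ in _, _ in _] => hXX.
have a0 : 0 < #|X|%:R :> R by rewrite ltr0n.
have hS : #|X|%:R ^+ 2 / 2 <= \sum_(d in S) #|diff_reps X d|%:R :> R.
  have h1 : \sum_(d | d \notin S) #|diff_reps X d|%:R
      <= #|XX|%:R * (#|X|%:R / (2 * K)) :> R.
    rewrite (bigID (mem XX)) /= [X in _ + X]big1 ?addr0 => [|d /andP[_ dXX]].
      apply: (@le_trans _ _ (\sum_(d in XX) (#|X|%:R / (2 * K) : R))).
        rewrite big_mkcond [leRHS]big_mkcond /=; apply: ler_sum => d _.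
        have h0 : 0 <= #|X|%:R / (2 * K) :> R.
          by rewrite divr_ge0 ?mulr_ge0 ?ler0n // ltW.
        by case: (d \in XX); rewrite ?andbF // andbT inE -ltNge; case: ltP => // /ltW.
      exact: sum_le_card.
    apply/eqP; rewrite pnatr_eq0 cards_eq0; apply/eqP/setP => x; rewrite inE in_set0.
    apply/negP => /andP[xX dX]; case/negP: dXX; apply/imset2P.
    by exists x (x - d); rewrite // opprB addrC subrK.
  have h2 : #|XX|%:R * (#|X|%:R / (2 * K)) <= #|X|%:R ^+ 2 / 2 :> R.
    have := ler_wpM2r (ltW (divr_gt0 a0 (mulr_gt0 (ltr0n R 2) K0))) hXX.
    move=> /le_trans; apply; rewrite le_eqVlt; apply/orP; left; apply/eqP.
    by field; rewrite lt0r_neq0.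
  have := sum_diff_reps R X; rewrite (bigID (mem S)) /=; move: h1 h2.
  by move: (\sum_(d in S) _) => u; move: (\sum_(d | _) _) => v; lra.
have [|x xX] := @exists_ge_of_sum R _ X
   (fun x => #|[set y in X | y - x \in S]|%:R) (#|X|%:R / 2) X0; last by exists x.
rewrite mulrA -expr2; apply: le_trans hS _.
under eq_bigr do rewrite natr_card_sum.
under [leRHS]eq_bigr do rewrite natr_card_sum.
rewrite exchange_big /=; apply: ler_sum => x xX.
rewrite (reindex_inj (inj_comp (addrI x) (@oppr_inj Z))) /=.
rewrite big_mkcond [leRHS]big_mkcond /=; apply: ler_sum => y _.
rewrite opprB addrCA subrr addr0.
case: (boolP (x - y \in S)) => [/popularN|hn]; last by case: (y \in X).
by rewrite opprB => ->; case: (y \in X).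
Qed.

(* Telescoping: [s1 + s2 + s3 + s4 = x1 - w1 - w2 - w3 - y] with [x1, y] in [X] and
   the [w_i] in [X - X], in as many ways as the [s_i] have representations. *)
Lemma card_popular_sums_le X S K :
  0 < K -> (0 < #|X|)%N ->
  #|[set x - y | x in X, y in X]|%:R <= K * #|X|%:R :> R ->
  S \subset popular X (#|X|%:R / (2 * K)) ->
  #|sums S (sums S (sums S S))|%:R <= 16 * K ^+ 7 * #|X|%:R :> R.
Proof.
move=> K0 X0; set XX := [set _ | _ in _, _ in _] => hXX /subsetP hS.
pose Q := setX X (setX XX (setX XX (setX XX X))).
pose f (t : Z * (Z * (Z * (Z * Z)))) :=
  t.1 - t.2.1 - t.2.2.1 - t.2.2.2.1 - t.2.2.2.2.
have a0 : 0 < #|X|%:R :> R by rewrite ltr0n.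
have : #|sums S (sums S (sums S S))|%:R * (#|X|%:R / (2 * K)) ^+ 4 <= #|Q|%:R :> R.
  apply: (@card_fibers_le R _ _ f) => _ /imset2P[s1 _ /hS h1 /imset2P[s2 _ /hS h2
    /imset2P[s3 s4 /hS h3 /hS h4 ->] ->] ->].
  pose g (t : Z * (Z * (Z * Z))) := (t.1, (t.1 - s1 - t.2.1,
    (t.2.1 - s2 - t.2.2.1, (t.2.2.1 - s3 - t.2.2.2, t.2.2.2 - s4)))).
  have gI : injective g.
    move=> [x1 [x2 [x3 x4]]] [y1 [y2 [y3 y4]]] [] /= -> /addrI /oppr_inj ->.
    by move=> /addrI /oppr_inj -> /addrI /oppr_inj ->.
  apply: (@le_trans _ _ #|setX (diff_reps X s1) (setX (diff_reps X s2)
      (setX (diff_reps X s3) (diff_reps X s4)))|%:R).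
    rewrite !cardsX !natrM exprS exprS exprS expr1.
    have c0 : 0 <= #|X|%:R / (2 * K) :> R.
      by rewrite divr_ge0 ?mulr_ge0 ?ler0n // ltW.
    move: h1 h2 h3 h4 c0; rewrite !inE; move: (#|X|%:R / _) => c h1 h2 h3 h4 c0.
    by do 3![apply: ler_pM => //; rewrite ?mulr_ge0 //].
  rewrite ler_nat -(card_imset _ gI); apply: subset_leq_card.
  have XXP u v : u \in X -> v \in X -> u - v \in XX.
    by move=> uX vX; apply/imset2P; exists u v.
  apply/subsetP => z /imsetP[[x1 [x2 [x3 x4]]] hx ->].
  rewrite !in_setX /= !inE in hx; have /and4P[/andP[x1X y1X] /andP[x2X y2X]
    /andP[x3X y3X] /andP[x4X y4X]] := hx.
  rewrite inE; apply/andP; split; first by rewrite !in_setX /= x1X !XXP //= y4X.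
  have tel u x s y : u + x - (x - s - y) = u + s + y.
    by rewrite !opprB -addrA [x + _]addrCA [x + _]addrC subrK [y + s]addrC addrA.
  rewrite /f /=; have := tel 0 x1 s1 x2; rewrite !add0r => ->; rewrite !tel.
  by rewrite opprB -addrA [x4 + _]addrC subrK -!addrA.
rewrite !cardsX !natrM; move: a0 hXX.
move: #|X|%:R #|XX|%:R (ler0n R #|XX|) => x w w0 x0 wK h.
(* Dividing [K^3 |X|^5] by the multiplicity [(|X| / (2 K))^4] produces the constant [16 K^7]. *)
have h1 : x * (w * (w * (w * x))) <= K ^+ 3 * x ^+ 5.
  have -> : K ^+ 3 * x ^+ 5 = x * (K * x * (K * x * (K * x * x))) by ring.
  by rewrite ler_pM2l // !ler_pM ?mulr_ge0 // ltW.
have c0 : 0 < x / (2 * K) by rewrite divr_gt0 // mulr_gt0.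
rewrite -(ler_pM2r (exprn_gt0 4 c0)); apply: le_trans h (le_trans h1 _).
by rewrite le_eqVlt; apply/orP; left; apply/eqP; field; rewrite lt0r_neq0.
Qed.

(** Take a maximal [Y] in [3S] whose nonzero differences avoid [2S]. As [S = -S], the translates
    [y + S] are disjoint, and they lie in [4S], which bounds [|Y|]; by maximality every point of
    [3S] differs from some point of [Y] by an element of [2S]. *)
Lemma ruzsa_covering S :
  0 \in S -> (forall x, x \in S -> - x \in S) ->
  exists Y : {set Z}, (#|Y| * #|S| <= #|sums S (sums S (sums S S))|)%N /\
    sums S (sums S S) \subset sums Y (sums S S).
Proof.
move=> S0 SN; have SS0 : 0 \in sums S S by rewrite -[0]addr0 mem_sums.
pose P (Y : {set Z}) := (Y \subset sums S (sums S S)) &&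
  [forall y in Y, forall z in Y, (y != z) ==> (y - z \notin sums S S)].
have P0 : P set0.
  by rewrite /P sub0set; apply/forall_inP => y; rewrite inE.
case: (@arg_maxnP _ set0 P (fun Y => #|Y|) P0) => Y /andP[YS /forall_inP sep] maxY.
exists Y; split.
  rewrite -cardsX -(card_in_imset (f := fun t => t.2 + t.1)).
    apply: subset_leq_card; apply/subsetP => z /imsetP[[y s]].
    rewrite in_setX /= => /andP[/(subsetP YS) yS sS] ->.
    exact: mem_sums.
  move=> [y s] [z t]; rewrite !in_setX /= => /andP[yY sS] /andP[zY tS] e.
  suff yz : y = z by move: e; rewrite yz => /addIr ->.
  apply/eqP; apply: contraT => ne; have /forall_inP := sep y yY.
  move=> /(_ z zY); rewrite ne /= => /negP[].
  have -> : y - z = t - s.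
    by apply/eqP; rewrite subr_eq addrAC eq_sym subr_eq -e addrC.
  by rewrite mem_sums // SN.
apply/subsetP => x xS; case: (boolP (x \in Y)) => [xY|xnY].
  by rewrite -[x]addr0 mem_sums.
have : ~~ P (x |: Y) by apply/negP => /maxY; rewrite cardsU1 xnY /= add1n ltnn.
have step y : y \in Y -> x - y \in sums S S -> x \in sums Y (sums S S).
  by move=> yY h; rewrite -[x](subrK y) addrC mem_sums.
rewrite /P subUset sub1set xS YS /= => /forall_inPn[y].
rewrite in_setU1 => yxY /forall_inPn[z]; rewrite in_setU1 => zxY.
rewrite negb_imply negbK => /andP[ne h].
have hN t : t \in sums S S -> - t \in sums S S.
  by move=> /imset2P[u v uS vS ->]; rewrite opprD mem_sums ?SN.
case/orP: yxY => [/eqP e|yY]; case/orP: zxY => [/eqP e'|zY].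
- by rewrite e e' eqxx in ne.
- by apply: (step z) => //; rewrite -e.
- by apply: (step y) => //; rewrite -e' -opprB hN.
- by have /forall_inP /(_ z zY) := sep y yY; rewrite ne h.
Qed.

(** In a finite group this already describes the subgroups, inverses being multiples. *)
Definition add_closed (H : {set Z}) :=
  0 \in H /\ forall x y, x \in H -> y \in H -> x + y \in H.

Lemma exists_span p Y : (0 < p)%N -> (forall z : Z, z *+ p = 0) ->
  exists H : {set Z}, [/\ add_closed H, Y \subset H & (#|H| <= p ^ #|Y|)%N].
Proof.
move=> p0 tors.
pose F (c : {ffun 'I_#|Y| -> 'I_p}) := \sum_i enum_val i *+ c i.
exists [set F c | c : {ffun 'I_#|Y| -> 'I_p}]; split.
- split.
    apply/imsetP; exists [ffun=> Ordinal p0] => //.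
    by rewrite /F big1 // => i _; rewrite ffunE.
  move=> _ _ /imsetP[c _ ->] /imsetP[d _ ->]; apply/imsetP.
  exists [ffun i => Ordinal (ltn_pmod (c i + d i) p0)] => //.
  rewrite /F -big_split /=; apply: eq_bigr => i _; rewrite ffunE /= -mulrnDr.
  by rewrite [in LHS](divn_eq (c i + d i) p) mulrnDr mulnC mulrnA tors mul0rn add0r.
- apply/subsetP => y yY; apply/imsetP.
  (* For [p = 1] the type ['I_p] has no coefficient [1], but torsion then makes [y] zero. *)
  have [p1|p1] := leqP p 1.
    exists [ffun=> Ordinal p0] => //; rewrite /F big1 => [|i _]; last by rewrite ffunE.
    by have := tors y; have -> : p = 1%N by apply/eqP; rewrite eqn_leq p1.
  exists [ffun i => if i == enum_rank_in yY y then Ordinal p1 else Ordinal p0] => //.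
  rewrite /F (bigD1 (enum_rank_in yY y)) //= ffunE eqxx enum_rankK_in //.
  by rewrite big1 ?addr0 // => i /negPf ni; rewrite ffunE ni.
- by apply: leq_trans (leq_imset_card _ _) _; rewrite card_ffun !card_ord.
Qed.

(* Since [3S] is covered by [Y + 2S], the set [span Y + 2S] is closed under
   addition. *)
Lemma exists_small_closure p S :
  (0 < p)%N -> (forall z : Z, z *+ p = 0) ->
  0 \in S -> (forall x, x \in S -> - x \in S) ->
  exists (m : nat) (H : {set Z}), let S4 := sums S (sums S (sums S S)) in
    [/\ add_closed H, S \subset H, (m * #|S| <= #|S4|)%N
      & (#|H| <= p ^ m * #|S4|)%N].
Proof.
move=> p0 tors S0 SN; have [Y [Ycard /subsetP cov]] := ruzsa_covering S0 SN.
have [L [[L0 LD] /subsetP YL Lcard]] := exists_span Y p0 tors.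
have SS0 : 0 \in sums S S by rewrite -[0]addr0 mem_sums.
exists #|Y|, (sums L (sums S S)) => /=; split => //.
- split; first by rewrite -[0]addr0 mem_sums.
  move=> x y /imset2P[u s uL sS ->] /imset2P[v t vL tS ->].
  rewrite addrACA; case/imset2P: sS => s1 s2 s1S s2S ->.
  (* Two applications of the covering bring the four summands from [S] back to two. *)
  have [y1 t1 /YL y1L t1S e1] := imset2P (cov _ (mem_sums s2S tS)).
  have [y2 t2 /YL y2L t2S e2] := imset2P (cov _ (mem_sums s1S t1S)).
  by rewrite -(addrA s1) e1 [s1 + (_ + _)]addrCA e2 !addrA mem_sums // LD // LD // LD.
- apply/subsetP => s sS; rewrite -[s]add0r mem_sums // -[s]addr0 mem_sums //.
- rewrite (@leq_trans #|[set t.1 + t.2 | t in setX L (sums S S)]|) //.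
    apply: subset_leq_card; apply/subsetP => _ /imset2P[u v uL vS ->].
    by apply/imsetP; exists (u, v); rewrite ?in_setX ?uL.
  rewrite (leq_trans (leq_imset_card _ _)) // cardsX leq_mul //.
  apply: subset_leq_card; apply/subsetP => s sS.
  by rewrite -[s]add0r mem_sums // -[s]add0r mem_sums.
Qed.

End ApproximateSubgroup.

(** [H] is the closure of the set [S] of popular differences of the Balog-Szemeredi-Gowers set [X].
    A translate of [S] contains half of [X], while [4S] has size [O(|X|)], so the covering number is
    bounded. The constants precede [Z] because the lemma is applied in every dimension. *)
Lemma approximate_subgroup (R : archiRealFieldType) (p : nat) (delta : R) :
  (0 < p)%N -> 0 < delta ->
  exists K c : R, [/\ 0 < K, 0 < c & forall (Z : finZmodType) (A : {set Z}),
    (forall z : Z, z *+ p = 0) -> (0 < #|A|)%N ->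
    delta * #|A|%:R ^+ 2 <= \sum_(b in A) #|[set x in A | x + b \in A]|%:R ->
    exists (H : {set Z}) (a : Z), [/\ add_closed H, #|H|%:R <= K * #|A|%:R &
      c * #|A|%:R <= #|[set x in A | x - a \in H]|%:R]].
Proof.
(* [|X - X| <= 1024 |A| / delta^5] and [|A| <= 4 |X| / delta]. *)
move=> p0 d0; pose K := 4096 / delta ^+ 6.
have K0 : 0 < K by rewrite divr_gt0 // exprn_gt0.
(* The covering number [m] satisfies [m |S| <= 16 K^7 |X|], and [|S| >= |X| / 2]. *)
pose m0 := Num.Def.truncn (32 * K ^+ 7).
exists (p%:R ^+ m0 * (16 * K ^+ 7)), (delta / 8); split.
- by rewrite mulr_gt0 ?exprn_gt0 ?ltr0n // mulr_gt0 // exprn_gt0.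
- by rewrite divr_gt0.
move=> Z A tors A0 hA.
have [X [/subsetP XA Xbig XX]] := balog_szemeredi_gowers d0 A0 hA.
have a0 : 0 < #|A|%:R :> R by rewrite ltr0n.
have x0 : 0 < #|X|%:R :> R by apply: lt_le_trans Xbig; rewrite mulr_gt0 ?divr_gt0.
have X0 : (0 < #|X|)%N by rewrite -(ltr0n R).
have hK : #|[set x - y | x in X, y in X]|%:R <= K * #|X|%:R :> R.
  have h5 : 0 < delta ^+ 5 / 1024 by rewrite divr_gt0 ?exprn_gt0.
  rewrite -(ler_pM2r h5); apply: le_trans XX _.
  have /(ler_wpM2l (ltW (divr_gt0 (ltr0n R 4) d0))) := Xbig.
  rewrite [leLHS](_ : _ = #|A|%:R); last by field; rewrite lt0r_neq0.
  move=> /le_trans; apply; rewrite le_eqVlt; apply/orP; left; apply/eqP.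
  by rewrite /K; field; rewrite lt0r_neq0.
set S := popular X (#|X|%:R / (2 * K)).
have S0 : 0 \in S.
  apply: zero_popular => //; apply: le_trans hK; rewrite ler_nat.
  case/card_gt0P: X0 => x1 x1X; rewrite -(card_imset X (addIr (- x1))).
  by apply: subset_leq_card; apply/subsetP => _ /imsetP[x xX ->]; apply/imset2P; exists x x1.
have SN x : x \in S -> - x \in S by exact: popularN.
have [a ha] := exists_popular_translate K0 X0 hK.
have S4le := card_popular_sums_le K0 X0 hK (subxx S).
have [m [H [Hadd /subsetP SH mle Hle]]] := exists_small_closure p0 tors S0 SN.
have Sbig : #|X|%:R / 2 <= #|S|%:R :> R.
  apply: le_trans ha _; rewrite ler_nat -(card_imset _ (addIr (- a))).
  by apply: subset_leq_card; apply/subsetP => z /imsetP[x]; rewrite inE => /andP[_ xS] ->.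
have mm0 : (m <= m0)%N.
  have h32 : 0 <= 32 * K ^+ 7 by rewrite mulr_ge0 // exprn_ge0 // ltW.
  rewrite /m0 truncn_ge_nat // -(ler_pM2r x0).
  have : m%:R * #|S|%:R <= 16 * K ^+ 7 * #|X|%:R.
    by apply: le_trans S4le; rewrite -natrM ler_nat.
  have := ler_wpM2l (ler0n R m) Sbig; lra.
exists H, a; split => //.
  have K7 : 0 <= 16 * K ^+ 7 by rewrite mulr_ge0 ?exprn_ge0 // ltW.
  apply: (@le_trans _ _ (p%:R ^+ m * (16 * K ^+ 7 * #|X|%:R))).
    apply: (@le_trans _ _ (p ^ m * #|sums S (sums S (sums S S))|)%:R).
      by rewrite ler_nat.
    by rewrite natrM natrX ler_wpM2l // exprn_ge0 ?ler0n.
  rewrite -[leRHS]mulrA; apply: ler_pM.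
  - by rewrite exprn_ge0 ?ler0n.
  - by rewrite mulr_ge0 ?ler0n.
  - by rewrite ler_weXn2l // ler1n.
  - by apply: ler_wpM2l; rewrite ?ler_nat // subset_leq_card //; apply/subsetP.
apply: (@le_trans _ _ (#|X|%:R / 2)); first by move: Xbig; lra.
apply: le_trans ha _; rewrite ler_nat; apply: subset_leq_card.
by apply/subsetP => x; rewrite in_set => /andP[xX xS]; rewrite in_set XA ?SH.
Qed.

(** * Squared moduli and additive characters *)

Section SquaredModulus.
Variable R : rcfType.
Implicit Types z w : R[i].

(** The squared modulus is kept in [R] rather than in [R[i]], so that estimates are inequalities
    between reals. *)
Definition sqn z : R := complex.Re z ^+ 2 + complex.Im z ^+ 2.

Lemma sqnE z : (sqn z)%:C = z * conj z.
Proof.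
rewrite -sqr_normc; case: z => a b.
by rewrite normc_def -rmorphXn /= sqr_sqrtr ?addr_ge0 ?sqr_ge0.
Qed.

Lemma sqn_ge0 z : 0 <= sqn z.
Proof. by rewrite addr_ge0 ?sqr_ge0. Qed.

Lemma sqnM z w : sqn (z * w) = sqn z * sqn w.
Proof. by case: z w => [a b] [c d]; rewrite /sqn /=; ring. Qed.

Lemma sqnJ z : sqn (conj z) = sqn z.
Proof. by case: z => a b; rewrite /sqn /= sqrrN. Qed.

Lemma sqn_real (x : R) : sqn x%:C = x ^+ 2.
Proof. by rewrite /sqn /= expr0n addr0. Qed.

Lemma sqn_sum_le (I : finType) (P : pred I) (F : I -> R[i]) :
  sqn (\sum_(i | P i) F i) <= #|P|%:R * \sum_(i | P i) sqn (F i).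
Proof.
have sq (G : I -> R) : (\sum_(i | P i) G i) ^+ 2 <= #|P|%:R * \sum_(i | P i) G i ^+ 2.
  have [P0|P0] := posnP #|P|.
    rewrite P0 mul0r big1 ?expr0n // => i Pi.
    by move: P0; rewrite (cardD1 i) unfold_in Pi.
  have c0 : 0 < #|P|%:R :> R by rewrite ltr0n.
  set m := (\sum_(i | P i) G i) / #|P|%:R.
  have : 0 <= \sum_(i | P i) (G i - m) ^+ 2 by apply: sumr_ge0 => i _; apply: sqr_ge0.
  rewrite (eq_bigr (fun i => G i ^+ 2 - 2 * m * G i + m ^+ 2)); last by move=> i _; ring.
  rewrite big_split sumrB -mulr_sumr sumr_const -[_ *+ #|_|]mulr_natl.
  have -> : \sum_(i | P i) G i = m * #|P|%:R by rewrite /m divfK // lt0r_neq0.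
  move: (\sum_(i | P i) _) => s h.
  have -> : (m * #|P|%:R) ^+ 2 = #|P|%:R * (#|P|%:R * m ^+ 2) by ring.
  by rewrite ler_pM2l //; move: h => /=; lra.
have re : {morph @complex.Re R : x y / x + y >-> x + y} by move=> [? ?] [? ?].
have im : {morph @complex.Im R : x y / x + y >-> x + y} by move=> [? ?] [? ?].
rewrite /sqn (big_morph _ re (erefl _)) (big_morph _ im (erefl _)) big_split mulrDr.
exact: lerD.
Qed.

End SquaredModulus.

Section Character.
Variables (R : rcfType) (p : nat).

Record additive_character (e : 'F_p -> R[i]) : Prop := AdditiveCharacter {
  charD : forall x y, e (x + y) = e x * e y;
  charN : forall x, e (- x) = conj (e x);
  char0 : e 0 = 1;
  char_nontrivial : e 1 != 1 }.

Lemma exists_character : prime p -> exists e, additive_character e.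
Proof.
(* A root of [1 + X + ... + X^(p-1)] is a [p]-th root of unity, and it is not [1] because the
   polynomial takes the value [p] there. *)
move=> pr_p; pose P : {poly R[i]} := \poly_(i < p) 1.
have p1 := prime_gt1 pr_p; have p0 := prime_gt0 pr_p.
have [|z rz] := closed_rootP P _.
  by rewrite size_poly_eq ?oner_eq0 // neq_ltn p1 orbT.
have zp : z ^+ p = 1.
  apply/eqP; rewrite -subr_eq0 subrX1.
  suff -> : \sum_(i < p) z ^+ i = 0 by rewrite mulr0.
  move: rz; rewrite /root /P horner_poly => /eqP h; rewrite -[RHS]h.
  by apply: eq_bigr => i _; rewrite mul1r.
have z1 : z != 1.
  apply: contraL rz => /eqP ->; rewrite /root horner_poly.
  under eq_bigr do rewrite expr1n mulr1.
  by rewrite sumr_const card_ord pnatr_eq0 -lt0n.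
have zz : z * conj z = 1.
  rewrite -sqr_normc; have : `|z| ^+ p = 1 by rewrite -normrX zp normr1.
  by move=> /eqP; rewrite pexpr_eq1 // => /eqP ->; rewrite expr1n.
have eD (x y : 'F_p) : z ^+ (x + y)%R = z ^+ x * z ^+ y.
  by rewrite -exprD /= expr_mod // Fp_cast.
exists (fun x => z ^+ x); apply: AdditiveCharacter => [x y|x||]; first exact: eD.
  have h : z ^+ (- x)%R * z ^+ x = 1 by rewrite -eD addNr.
  have zx : z ^+ x * conj (z ^+ x) = 1.
    by rewrite rmorphXn -exprMn /= zz expr1n.
  by rewrite -[LHS]mulr1 -zx mulrA h mul1r.
  by rewrite /= expr0.
by rewrite /= modn_small ?Fp_cast.
Qed.

End Character.

(** * Fourier analysis on [F_p^N] and the function [W] *)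

Section Fourier.
Variables (R : rcfType) (p : nat) (e : 'F_p -> R[i]) (he : additive_character e).
Variable N : nat.
Local Notation V := 'rV['F_p]_N.
Local Notation q := (#|{: V}|%:R).
Implicit Types (f g : V -> R[i]) (x y h xi : V).

Definition dot x y : 'F_p := (x *m y^T) 0 0.

Lemma dotC x y : dot x y = dot y x.
Proof. by rewrite /dot -[x *m _]trmxK trmx_mul trmxK mxE. Qed.
Lemma dotDl x y z : dot (x + y) z = dot x z + dot y z.
Proof. by rewrite /dot mulmxDl mxE. Qed.
Lemma dotDr x y z : dot x (y + z) = dot x y + dot x z.
Proof. by rewrite dotC dotDl !(dotC x). Qed.
Lemma dotNl x y : dot (- x) y = - dot x y.
Proof. by rewrite /dot mulNmx mxE. Qed.
Lemma dotNr x y : dot x (- y) = - dot x y.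
Proof. by rewrite dotC dotNl dotC. Qed.
Lemma dotBl x y z : dot (x - y) z = dot x z - dot y z.
Proof. by rewrite dotDl dotNl. Qed.
Lemma dotBr x y z : dot x (y - z) = dot x y - dot x z.
Proof. by rewrite dotDr dotNr. Qed.
Lemma dot0l x : dot 0 x = 0.
Proof. by rewrite /dot mul0mx mxE. Qed.
Lemma dot_mulmx x y (T : 'M['F_p]_N) : dot (x *m T) y = dot x (y *m T^T).
Proof. by rewrite /dot trmx_mul trmxK mulmxA. Qed.

Lemma sqn_char t : sqn (e t) = 1.
Proof.
by apply: (@complexI R); rewrite sqnE -(charN he) -(charD he) subrr (char0 he).
Qed.

Lemma sum_char_dot x :
  \sum_y e (dot y x) = if x == 0 then q else 0.
Proof.
case: eqP => [->|/eqP x0].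
  under eq_bigr do rewrite dotC dot0l (char0 he).
  by rewrite sumr_const.
have [j xj] : exists j, x 0 j != 0.
  apply/existsP; apply: contraNT x0 => /existsPn h; apply/eqP/rowP => j.
  by rewrite mxE; apply/eqP; rewrite -[_ == _]negbK h.
(* Shifting [y] by [y0] multiplies the sum by [e 1], which is not [1]. *)
pose y0 : V := (x 0 j)^-1 *: delta_mx 0 j.
have d1 : dot y0 x = 1.
  rewrite /dot -scalemxAl mxE -rowE !mxE mulVf //.
have : (\sum_y e (dot y x)) * (e 1 - 1) = 0.
  rewrite mulrBr mulr1 [X in _ - X](reindex_inj (addIr y0)) mulr_suml -sumrB big1 //.
  by move=> y _; rewrite /= dotDl d1 (charD he) subrr.
by move/eqP; rewrite mulf_eq0 subr_eq0 (negPf (char_nontrivial he)) orbF => /eqP.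
Qed.

Lemma sum_char_dot_sub (F : V -> R[i]) a :
  \sum_y F y * \sum_xi e (dot xi (y - a)) = q * F a.
Proof.
rewrite (bigD1 a) //= sum_char_dot subrr eqxx mulrC big1 ?addr0 // => y ya.
by rewrite sum_char_dot subr_eq0 (negPf ya) mulr0.
Qed.

Definition ft g xi := \sum_x g x * e (- dot xi x).

Lemma parseval g : \sum_xi sqn (ft g xi) = q * \sum_x sqn (g x).
Proof.
apply: (@complexI R); rewrite rmorphM !rmorph_sum /= rmorph_nat mulr_sumr.
under eq_bigr do rewrite sqnE /ft rmorph_sum mulr_suml.
rewrite exchange_big /=; apply: eq_bigr => a _.
rewrite sqnE mulrCA -(sum_char_dot_sub (fun y => conj (g y))).
transitivity (\sum_xi \sum_y g a * (conj (g y) * e (dot xi (y - a)))).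
  apply: eq_bigr => xi _; rewrite mulr_sumr; apply: eq_bigr => y _ /=.
  rewrite rmorphM /= -(charN he) opprK dotBr (charD he); ring.
rewrite exchange_big /= mulr_sumr; apply: eq_bigr => y _.
by rewrite -!mulr_sumr.
Qed.

Definition autocorr g h := \sum_x g (x + h) * conj (g x).

(** Parseval for [autocorr g], whose transform is the squared modulus of [ft g]. Up to normalization
    both sides are the fourth power of the U^2 norm of [g]. *)
Lemma sum_sqn_ft_sq g : \sum_xi sqn (ft g xi) ^+ 2 = q * \sum_h sqn (autocorr g h).
Proof.
rewrite -parseval; apply: eq_bigr => xi _; rewrite -sqn_real; congr sqn.
rewrite sqnE /ft rmorph_sum mulr_sumr.
under [RHS]eq_bigr do rewrite /autocorr mulr_suml.
rewrite [RHS]exchange_big /=; apply: eq_bigr => y _.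
rewrite mulr_suml (reindex_inj (addrI y)) /=; apply: eq_bigr => h _.
rewrite rmorphM /= -(charN he) opprK dotDr opprD (charD he).
have : e (- dot xi y) * e (dot xi y) = 1 by rewrite -(charD he) addNr (char0 he).
by move=> E; rewrite -[RHS]mulr1 -E; ring.
Qed.

Definition corr f h := ft (fun x => f (x + h) * conj (f x)).

(** This is [W], normalized so that for [f] bounded by [1] its values lie in [[0, 1]] and each line
    of fixed [h] has mass at most [1]. *)
Definition wigner f (z : V * V) : R := sqn (corr f z.1 z.2) / q ^+ 2.

Definition symp (z w : V * V) := dot z.1 w.2 - dot z.2 w.1.

Lemma card_gt0 : 0 < q :> R.
Proof. by rewrite ltr0n; apply/card_gt0P; exists 0. Qed.

Lemma wigner_ge0 f z : 0 <= wigner f z.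
Proof. by rewrite divr_ge0 ?sqn_ge0 ?exprn_ge0. Qed.

Section Bounded.
Variable f : V -> R[i].
Hypothesis f_le1 : forall x, sqn (f x) <= 1.

Lemma sqn_shift_le1 h x : sqn (f (x + h) * conj (f x)) <= 1.
Proof. by rewrite sqnM sqnJ mulr_ile1 ?sqn_ge0. Qed.

Lemma wigner_le1 z : wigner f z <= 1.
Proof.
rewrite ler_pdivrMr ?exprn_gt0 ?card_gt0 // mul1r expr2.
apply: le_trans (sqn_sum_le _ _) _; rewrite ler_wpM2l //.
apply: le_trans (_ : \sum_(x : V) 1 <= _); last by rewrite sumr_const.
by apply: ler_sum => x _; rewrite sqnM sqn_char mulr1 sqn_shift_le1.
Qed.

Lemma sum_wigner_snd_le1 h : \sum_xi wigner f (h, xi) <= 1.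
Proof.
rewrite -mulr_suml ler_pdivrMr ?exprn_gt0 ?card_gt0 // mul1r expr2 /= /corr parseval.
rewrite ler_wpM2l //.
apply: le_trans (_ : \sum_(x : V) 1 <= _); last by rewrite sumr_const.
by apply: ler_sum => x _; rewrite sqn_shift_le1.
Qed.

Lemma sum_wigner_le : \sum_z wigner f z <= q.
Proof.
rewrite (eq_bigr (fun z => wigner f (z.1, z.2))) => [|[]//].
rewrite -(pair_big predT predT (fun h xi => wigner f (h, xi))) /=.
apply: le_trans (_ : \sum_(x : V) 1 <= _); last by rewrite sumr_const.
by apply: ler_sum => x _; apply: sum_wigner_snd_le1.
Qed.

End Bounded.

(** After expanding the square, the sum over [xi] forces [y = x + u]. The surviving product of
    values of [f] at [x], [x + h], [x + u], [x + u + h] is symmetric in [h] and [u], and summing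
    over [x] and [h] reassembles the square belonging to [(u, eta)]. *)
Lemma wigner_self_dual f w :
  \sum_z (wigner f z)%:C * e (symp z w) = q * (wigner f w)%:C.
Proof.
case: w => u eta; rewrite /wigner /symp /=.
rewrite rmorphM /= mulrA.
transitivity ((\sum_z (sqn (corr f z.1 z.2))%:C * e (symp z (u, eta))) *
    ((q ^+ 2)^-1)%:C).
  rewrite mulr_suml; apply: eq_bigr => z _; rewrite rmorphM /=; ring.
congr (_ * _).
transitivity (\sum_h \sum_xi (sqn (corr f h xi))%:C * e (symp (h, xi) (u, eta))).
  by rewrite pair_big; apply: eq_bigr => -[].
transitivity (\sum_h \sum_x (q * (f (x + h) * conj (f x) * conj (f (x + u + h))
    * f (x + u) * e (dot h eta)))).
  apply: eq_bigr => h _.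
  transitivity (\sum_xi \sum_x \sum_y f (x + h) * conj (f x) * conj (f (y + h))
      * f y * e (dot h eta) * e (dot xi (y - (x + u)))).
    apply: eq_bigr => xi _; rewrite sqnE /corr /ft rmorph_sum mulr_suml mulr_suml.
    apply: eq_bigr => x _; rewrite mulr_sumr mulr_suml; apply: eq_bigr => y _.
    rewrite /symp /= !rmorphM /= conjCK -(charN he) opprK.
    rewrite dotBr dotDr opprD addrA !(charD he); ring.
  rewrite exchange_big /=; apply: eq_bigr => x _; rewrite exchange_big /=.
  rewrite -(sum_char_dot_sub (fun y => f (x + h) * conj (f x) * conj (f (y + h))
      * f y * e (dot h eta))).
  by apply: eq_bigr => y _; rewrite -mulr_sumr.
rewrite sqnE /corr /ft rmorph_sum mulr_suml mulr_sumr exchange_big /=.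
apply: eq_bigr => x _; rewrite !mulr_sumr (reindex_inj (addIr (- x))) /=.
apply: eq_bigr => t _.
have E : x + (t - x) = t by rewrite addrCA subrr addr0.
rewrite (addrAC x u) E dotBl !rmorphM /= conjCK -(charN he) opprK.
rewrite (charD he) (dotC t) (dotC x eta).
ring.
Qed.

Lemma sympDr z w1 w2 : symp z (w1 + w2) = symp z w1 + symp z w2.
Proof. by rewrite /symp /= !dotDr opprD addrACA. Qed.

Lemma sympN z w : symp z w = - symp w z.
Proof. by rewrite /symp opprB (dotC z.1) (dotC z.2). Qed.

Lemma wigner_self_dual_sym f w :
  \sum_z (wigner f z)%:C * e (symp w z) = q * (wigner f w)%:C.
Proof.
have cr (r : R) c : conj (r%:C * c) = r%:C * conj c.
  by rewrite rmorphM; congr (_ * _); apply: conjc_real.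
have := congr1 conj (wigner_self_dual f w).
rewrite mulrC cr rmorph_nat mulrC => <-; rewrite rmorph_sum; apply: eq_bigr => z _.
by rewrite sympN (charN he) -cr.
Qed.

(** Invariance under translation by [L] gives [S^2 = |L| S], so the sum [S] is [0] or [|L|]. *)
Lemma char_sum_ge0 (L : {set V * V}) w :
  add_closed L -> 0 <= \sum_(z in L) e (symp w z).
Proof.
move=> [L0 LD]; set S := \sum_(z in L) _.
have : S * (S - #|L|%:R) = 0.
  rewrite mulrBr /S mulr_suml.
  rewrite (eq_bigr (fun=> S)) => [|z zL].
    by rewrite sumr_const -/S mulr_natr subrr.
  rewrite /S mulr_sumr [RHS](reindex_inj (addrI z)) /= [RHS](eq_bigl (mem L)).
    by apply: eq_bigr => t _; rewrite sympDr (charD he).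
  move=> t /=.
  have sub : [set z + y | y in L] = L.
    apply/eqP; rewrite eqEcard card_imset ?leqnn ?andbT; last exact: addrI.
    by apply/subsetP => _ /imsetP[y yL ->]; apply: LD.
  apply/idP/idP => [|tL]; last exact: LD.
  by rewrite -{1}sub => /imsetP[y yL /addrI ->].
by move/eqP; rewrite mulf_eq0 subr_eq0 => /orP[] /eqP ->; rewrite ?lexx ?ler0n.
Qed.

(* By self-duality the left-hand side is the right-hand side with phases inserted
   into a sum of nonnegative terms. *)
Lemma sum_wigner_translate_le f (L : {set V * V}) a :
  add_closed L -> \sum_(z in L) wigner f (a + z) <= \sum_(z in L) wigner f z.
Proof.
move=> Ladd.
have E b : q * (\sum_(z in L) wigner f (b + z))%:C =
    \sum_w (wigner f w)%:C * e (symp w b) * \sum_(z in L) e (symp w z).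
  rewrite rmorph_sum mulr_sumr.
  rewrite (eq_bigr (fun z => \sum_w (wigner f w)%:C * e (symp w (b + z)))); last first.
    by move=> z _; rewrite wigner_self_dual.
  rewrite exchange_big /=; apply: eq_bigr => w _; rewrite mulr_sumr.
  by apply: eq_bigr => z _; rewrite sympDr (charD he) mulrA.
have q0 : (0 : R[i]) < q by rewrite ltr0n; apply/card_gt0P; exists 0.
rewrite -lecR -(ler_pM2l q0).
have nn b : 0 <= (\sum_(z in L) wigner f (b + z))%:C.
  by rewrite lecR; apply: sumr_ge0 => z _; apply: wigner_ge0.
have := E 0; rewrite (eq_bigr (wigner f)) => [->|z _]; last by rewrite add0r.
rewrite -[leLHS]ger0_norm ?mulr_ge0 ?ler0n // E.
apply: le_trans (ler_norm_sum _ _ _) _; apply: ler_sum => w _.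
have nc t : `|e t| = 1.
  apply/eqP; rewrite -(@pexpr_eq1 _ _ 2) // sqr_normc.
  by rewrite -[_ * _]sqnE sqn_char.
rewrite !normrM nc mulr1 ger0_norm ?(ger0_norm (char_sum_ge0 _ _)) ?lecR ?wigner_ge0 //.
rewrite ler_wpM2r ?char_sum_ge0 //.
by rewrite /symp dotC !dot0l dotC dot0l subrr (char0 he) mulr1.
Qed.

(** Writing [W(a + b)] as a transform factors the sums over [a] and [b] into the square of a
    transform of [W], which self-duality evaluates. *)
Lemma sum_wigner_triples f :
  \sum_a \sum_b wigner f a * wigner f b * wigner f (a + b) =
  q * \sum_a wigner f a ^+ 3.
Proof.
have q0 : q != 0 :> R[i] by rewrite lt0r_neq0 // ltr0n; apply/card_gt0P; exists 0.
apply: (@complexI R); apply: (mulfI q0).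
rewrite rmorphM rmorph_nat !rmorph_sum /= mulr_sumr.
transitivity (\sum_w (wigner f w)%:C * (\sum_a (wigner f a)%:C * e (symp w a)) ^+ 2).
  transitivity (\sum_a \sum_b \sum_w (wigner f w)%:C *
     ((wigner f a)%:C * e (symp w a) * ((wigner f b)%:C * e (symp w b)))).
    apply: eq_bigr => a _; rewrite rmorph_sum mulr_sumr; apply: eq_bigr => b _.
    have -> : q * (wigner f a * wigner f b * wigner f (a + b))%:C =
      (wigner f a)%:C * (wigner f b)%:C * (q * (wigner f (a + b))%:C).
      by rewrite !rmorphM; ring.
    rewrite -wigner_self_dual mulr_sumr; apply: eq_bigr => w _.
    rewrite sympDr (charD he); ring.
  rewrite (eq_bigr (fun a => \sum_w \sum_b (wigner f w)%:C *
     ((wigner f a)%:C * e (symp w a) * ((wigner f b)%:C * e (symp w b)))));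
    last by move=> a _; rewrite exchange_big.
  rewrite exchange_big /=; apply: eq_bigr => w _.
  rewrite expr2 mulr_suml mulr_sumr; apply: eq_bigr => a _.
  by rewrite mulr_sumr mulr_sumr.
rewrite mulr_sumr mulr_sumr; apply: eq_bigr => w _.
rewrite wigner_self_dual_sym rmorphXn /=; ring.
Qed.

End Fourier.

(** * From a large sum of [W^2] to a linear graph *)

Section LevelSet.
Variables (R : archiRcfType) (p : nat) (e : 'F_p -> R[i]) (he : additive_character e).

(** Summing [W (W - eta)^2 >= 0] gives a third moment of at least [eta^2 q], hence a weighted triple
    count of at least [eta^2 q^2]. With [tau = eta^2 / 4], triples having an entry outside [A]
    contribute at most [tau q^2] for each of the three positions of that entry, which leaves
    [tau q^2]. *)
Lemma wigner_level_triples N (f : 'rV['F_p]_N -> R[i]) (eta : R)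
    (A := [set z | eta ^+ 2 / 4 <= wigner e f z]) (q := #|{: 'rV['F_p]_N}|%:R : R) :
  (forall x, sqn (f x) <= 1) -> 0 < eta -> eta * q <= \sum_z wigner e f z ^+ 2 ->
  eta ^+ 2 / 4 * q ^+ 2 <= \sum_(b in A) #|[set x in A | x + b \in A]|%:R /\
  eta ^+ 2 / 4 * #|A|%:R <= q.
Proof.
move=> f1 eta0 large; set W := wigner e f; set tau := eta ^+ 2 / 4.
have W0 z : 0 <= W z by apply: wigner_ge0.
have W1 z : W z <= 1 by apply: (wigner_le1 he).
have sW : \sum_z W z <= q by apply: (sum_wigner_le he).
have q0 : 0 < q by apply: card_gt0.
have tau0 : 0 < tau by rewrite divr_gt0 ?exprn_gt0.
split; last first.
  apply: le_trans sW; rewrite mulrC; apply: (@le_trans _ _ (\sum_(z in A) W z)).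
    by apply: sum_ge_card => z; rewrite inE.
  by rewrite [leRHS](bigID (mem A)) /= lerDl; apply: sumr_ge0 => z _; apply: W0.
have cube : eta ^+ 2 * q <= \sum_z W z ^+ 3.
  have : \sum_z (2 * eta * W z ^+ 2 - eta ^+ 2 * W z) <= \sum_z W z ^+ 3.
    apply: ler_sum => z _; rewrite -subr_ge0.
    have -> : W z ^+ 3 - (2 * eta * W z ^+ 2 - eta ^+ 2 * W z) =
      W z * (W z - eta) ^+ 2 by ring.
    by rewrite mulr_ge0 ?sqr_ge0.
  rewrite sumrB -!mulr_sumr; apply: le_trans.
  have h1 := ler_wpM2l (ltW (mulr_gt0 (ltr0n R 2) eta0)) large.
  have h2 := ler_wpM2l (sqr_ge0 eta) sW.
  by move: h1 h2; rewrite -/W; lra.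
have pw a b : W a * W b * W (a + b) <= ((a \in A) && ((b \in A) && (b + a \in A)))%:R
    + tau * (W a * W b + W a * W (a + b) + W b * W (a + b)).
  have h1 := mulr_ge0 (W0 b) (W0 (a + b)); have h2 := mulr_ge0 (W0 a) (W0 (a + b)).
  have h3 := mulr_ge0 (W0 a) (W0 b).
  rewrite [b + a]addrC; have [hab|] := boolP [&& a \in A, b \in A & a + b \in A].
    rewrite -[leLHS]addr0 lerD //; last first.
      by rewrite mulr_ge0 ?(ltW tau0) // addr_ge0 // addr_ge0.
    by rewrite mulr_ile1 // mulr_ile1.
  rewrite add0r !inE -/W -/tau !negb_and -!ltNge.
  have t0 := ltW tau0.
  case/or3P => /ltW h.
  - rewrite -mulrA; apply: le_trans (ler_wpM2r h1 h) _.
    by rewrite ler_wpM2l // lerDr addr_ge0.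
  - rewrite [W a * _ in leLHS]mulrC -mulrA; apply: le_trans (ler_wpM2r h2 h) _.
    by rewrite ler_wpM2l // addrAC lerDr addr_ge0.
  - rewrite mulrC; apply: le_trans (ler_wpM2r h3 h) _.
    by rewrite ler_wpM2l // -addrA lerDl addr_ge0.
have sW0 : 0 <= \sum_z W z by apply: sumr_ge0 => z _; apply: W0.
have S1 : \sum_a \sum_b W a * W b <= q ^+ 2.
  under eq_bigr do rewrite -mulr_sumr.
  by rewrite -mulr_suml expr2 ler_pM .
have S2 : \sum_a \sum_b W a * W (a + b) <= q ^+ 2.
  rewrite (eq_bigr (fun a => W a * \sum_b W b)) => [|a _].
    by rewrite -mulr_suml expr2 ler_pM .
  by rewrite -mulr_sumr [in RHS](reindex_inj (addrI a)).
have S3 : \sum_a \sum_b W b * W (a + b) <= q ^+ 2.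
  rewrite exchange_big /= (eq_bigr (fun a => W a * \sum_b W b)) => [|a _].
    by rewrite -mulr_suml expr2 ler_pM .
  by rewrite -mulr_sumr [in RHS](reindex_inj (addIr a)).
have : \sum_a \sum_b W a * W b * W (a + b) <=
    \sum_a \sum_b (((a \in A) && ((b \in A) && (b + a \in A)))%:R
    + tau * (W a * W b + W a * W (a + b) + W b * W (a + b))).
  by apply: ler_sum => a _; apply: ler_sum => b _.
rewrite (sum_wigner_triples he) -/W.
have -> : \sum_(b in A) #|[set x in A | x + b \in A]|%:R =
    \sum_a \sum_b ((a \in A) && ((b \in A) && (b + a \in A)))%:R :> R.
  rewrite big_mkcond /=; apply: eq_bigr => a _; case: (a \in A) => /=; last first.
    by rewrite big1.
  rewrite natr_card_sum big_mkcond /=; apply: eq_bigr => b _.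
  by case: (b \in A).
set n := \sum_a \sum_b (_)%:R.
have -> : \sum_a \sum_b (((a \in A) && ((b \in A) && (b + a \in A)))%:R
    + tau * (W a * W b + W a * W (a + b) + W b * W (a + b))) =
  n + tau * (\sum_a \sum_b W a * W b + \sum_a \sum_b W a * W (a + b)
    + \sum_a \sum_b W b * W (a + b)).
  rewrite -!big_split mulr_sumr -big_split /=; apply: eq_bigr => a _.
  by rewrite -!big_split mulr_sumr -big_split.
have := ler_wpM2l (ltW q0) cube.
have := ler_wpM2l (ltW tau0) (lerD (lerD S1 S2) S3).
move: (\sum_a \sum_b W a * W b) (\sum_a \sum_b W a * W (a + b)) => s1 s2.
move: (\sum_a \sum_b _) (\sum_a _ ^+ 3) n => s3 s4 n h1 h2 h3.
have -> : tau * q ^+ 2 = q * (eta ^+ 2 * q) - tau * (q ^+ 2 + q ^+ 2 + q ^+ 2).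
  by rewrite /tau; field.
move: h1 h2 h3; move: (tau * _) (tau * _) (q * _) (q * _) => t1 t2 t3 t4; lra.
Qed.

End LevelSet.

Section LinearGraph.
Variables (R : archiRcfType) (p : nat) (e : 'F_p -> R[i]) (he : additive_character e).

Lemma exists_subgroup (eta : R) : prime p -> 0 < eta ->
  exists K c : R, [/\ 0 < K, 0 < c & forall N (f : 'rV['F_p]_N -> R[i]),
    (forall x, sqn (f x) <= 1) ->
    eta * #|{: 'rV['F_p]_N}|%:R <= \sum_z wigner e f z ^+ 2 ->
    exists H : {set 'rV['F_p]_N * 'rV['F_p]_N},
    [/\ add_closed H, #|H|%:R <= K * #|{: 'rV['F_p]_N}|%:R
      & c * #|{: 'rV['F_p]_N}|%:R <= \sum_(z in H) wigner e f z]].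
Proof.
move=> pr_p eta0; have [tau Etau tau0] : exists2 tau, tau = eta ^+ 2 / 4 & 0 < tau.
  by eexists => //; rewrite divr_gt0 ?exprn_gt0.
(* The triple count is relative to [q^2], and [tau |A| <= q]: so [tau q^2 >= tau^3 |A|^2]. *)
have [K [c [K0 c0 HK]]] := approximate_subgroup (prime_gt0 pr_p) (exprn_gt0 3 tau0).
exists (K / tau), (tau * (c * tau)); split.
- exact: divr_gt0.
- by rewrite mulr_gt0 // mulr_gt0.
move=> N f f1 large; set q := _%:R.
have [] := wigner_level_triples he f1 eta0 large; rewrite -Etau -/q.
set A := [set _ | _] => trip Ale.
have q0 : 0 < q by apply: card_gt0.
have tors (z : 'rV['F_p]_N * 'rV['F_p]_N) : z *+ p = 0.
  rewrite -scaler_nat; have [_ /eqP ->] := andP (pchar_Fp pr_p).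
  exact: scale0r.
have tripA : \sum_(b in A) #|[set x in A | x + b \in A]|%:R <= #|A|%:R * #|A|%:R :> R.
  apply: sum_le_card => b _; rewrite ler_nat; apply: subset_leq_card.
  by apply/subsetP => x; rewrite in_set => /andP[].
have A2 : tau * q ^+ 2 <= #|A|%:R ^+ 2 by rewrite expr2 -expr2; apply: le_trans trip _.
have A0 : (0 < #|A|)%N.
  rewrite lt0n; apply: contraL A2 => /eqP ->.
  by rewrite expr0n -ltNge mulr_gt0 ?exprn_gt0.
have tau1 : tau <= 1.
  have := wigner_le1 he f1; have /card_gt0P[z] := A0; rewrite inE => h /(_ z).
  exact: le_trans.
have Abig : tau * q <= #|A|%:R.
  rewrite -(@ler_pXn2r _ 2) ?nnegrE ?mulr_ge0 ?(ltW tau0) ?ler0n //.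
  apply: le_trans A2; rewrite exprMn ler_wpM2r ?sqr_ge0 //.
  by rewrite expr2 ler_piMl // ltW.
have hA : tau ^+ 3 * #|A|%:R ^+ 2 <= \sum_(b in A) #|[set x in A | x + b \in A]|%:R.
  apply: le_trans trip; rewrite exprS -mulrA ler_pM2l //.
  by rewrite -exprMn ler_pXn2r ?nnegrE ?mulr_ge0 ?(ltW tau0) ?(ltW q0) ?ler0n.
have [H [a [Hadd Hle Ha]]] := HK _ A tors A0 hA.
exists H; split => //.
  apply: le_trans Hle _; rewrite -mulrA ler_pM2l // mulrC ler_pdivlMr // mulrC.
  exact: Ale.
(* The mass is found on the coset [a + H], and the subgroup carries at least as much. *)
apply: le_trans (sum_wigner_translate_le he f a Hadd).
rewrite (reindex_inj (addrI (- a))) /=.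
apply: (@le_trans _ _ (\sum_(z in [set x in A | x - a \in H]) wigner e f z)).
  apply: le_trans (_ : #|[set x in A | x - a \in H]|%:R * tau <= _).
    apply: le_trans (_ : c * #|A|%:R * tau <= _); last by rewrite ler_pM2r.
    have -> : tau * (c * tau) * q = c * (tau * q) * tau by ring.
    by rewrite ler_pM2r // ler_pM2l.
  by apply: sum_ge_card => z; rewrite !inE => /andP[].
rewrite big_mkcond [leRHS]big_mkcond /=; apply: ler_sum => z _.
rewrite in_set [- a + z]addrC [a + _]addrC subrK.
by case: (z \in A); case: (z - a \in H) => //=; rewrite ?wigner_ge0.
Qed.

Lemma add_closed_scale N (H : {set 'rV['F_p]_N * 'rV['F_p]_N}) (a : 'F_p) z :
  add_closed H -> z \in H -> a *: z \in H.
Proof.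
move=> [H0 HD] zH; rewrite -[a]natr_Zp scaler_nat.
by elim: (nat_of_ord a) => [|n IHn]; rewrite ?mulr0n // mulrS HD.
Qed.

(** [T] extends a linear section of the first projection of [H]: [z.1] is written as a combination
    of first components of elements of [H], and the same coefficients are applied to the second
    components. *)
Lemma exists_graph_map N (H : {set 'rV['F_p]_N * 'rV['F_p]_N}) :
  add_closed H ->
  exists T : 'M['F_p]_N, forall z, z \in H -> (z.1, z.1 *m T) \in H.
Proof.
move=> Hadd; have [H0 HD] := Hadd.
pose M1 := \matrix_(i < #|H|) (enum_val i).1; pose M2 := \matrix_(i < #|H|) (enum_val i).2.
exists (pinvmx M1 *m M2) => z zH.
have z1M : (z.1 <= M1)%MS.
  have -> : z.1 = row (enum_rank_in zH z) M1 by rewrite rowK enum_rankK_in.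
  exact: row_sub.
rewrite mulmxA -[X in (X, _)](mulmxKpV z1M); move: (z.1 *m _) => u.
have -> : (u *m M1, u *m M2) = \sum_i u 0 i *: (enum_val i : _ * _).
  have add1 : {morph (fun z : 'rV['F_p]_N * 'rV['F_p]_N => z.1) : x y / x + y} by [].
  have add2 : {morph (fun z : 'rV['F_p]_N * 'rV['F_p]_N => z.2) : x y / x + y} by [].
  rewrite [RHS]surjective_pairing (big_morph _ add1 (erefl _)) (big_morph _ add2 (erefl _)).
  by congr (_, _); rewrite mulmx_sum_row; apply: eq_bigr => i _; rewrite rowK.
by elim/big_ind: _ => // i _; apply: add_closed_scale => //; apply: enum_valP.
Qed.

(* The subgroup [H] is a union of boundedly many translates of a graph, none of
   which carries more mass than the graph itself. *)
Lemma exists_large_graph (eta : R) : prime p -> 0 < eta ->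
  exists2 c : R, 0 < c & forall N (f : 'rV['F_p]_N -> R[i]),
    (forall x, sqn (f x) <= 1) ->
    eta * #|{: 'rV['F_p]_N}|%:R <= \sum_z wigner e f z ^+ 2 ->
    exists T : 'M['F_p]_N,
      c * #|{: 'rV['F_p]_N}|%:R <= \sum_h wigner e f (h, h *m T).
Proof.
move=> pr_p eta0; have [K [c [K0 c0 HK]]] := exists_subgroup pr_p eta0.
(* The projection [U] has at least [c q] elements, as each [h] carries mass at most [1]. With
   [|F| |U| = |H| <= K q], at most [K / c] translates of the graph share the mass [c q]. *)
exists (c ^+ 2 / K); first by rewrite divr_gt0 ?exprn_gt0.
move=> N f f1 large; have [H [Hadd Hle Hbig]] := HK N f f1 large.
set q : R := _%:R in Hle Hbig *; have q0 : 0 < q by apply: card_gt0.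
have [H0 HD] := Hadd; have [T HT] := exists_graph_map Hadd.
exists T; pose U := [set z.1 | z in H]; pose F := [set xi | (0, xi) \in H].
pose G := \sum_(h in U) wigner e f (h, h *m T).
have UP x : x \in U -> (x, x *m T) \in H by move=> /imsetP[z zH ->]; apply: HT.
have HN z : z \in H -> - z \in H by rewrite -scaleN1r; apply: add_closed_scale.
have memH x xi : ((x, x *m T + xi) \in H) = (x \in U) && (xi \in F).
  apply/idP/andP => [h|[xU]]; last first.
    rewrite inE => xiF; have -> : (x, x *m T + xi) = (x, x *m T) + (0, xi).
      by rewrite -[RHS]/(x + 0, x *m T + xi) addr0.
    by apply: HD => //; apply: UP.
  have xU : x \in U by apply/imsetP; exists (x, x *m T + xi).
  split=> //; rewrite inE; have -> : (0, xi) = - (x, x *m T) + (x, x *m T + xi).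
    by rewrite -[RHS]/(- x + x, - (x *m T) + (x *m T + xi)) addNr addKr.
  by apply: HD => //; apply/HN/UP.
have sumH (P : 'rV['F_p]_N * 'rV['F_p]_N -> R) : \sum_(z in H) P z =
    \sum_(xi in F) \sum_(h in U) P (h, h *m T + xi).
  transitivity (\sum_h \sum_xi if (h, xi) \in H then P (h, xi) else 0).
    by rewrite pair_big big_mkcond /=; apply: eq_bigr => -[].
  rewrite exchange_big /= (eq_bigr (fun xi => \sum_h
    if (h, xi) \in H then P (h, xi) else 0)) //.
  rewrite exchange_big [RHS]exchange_big /= [RHS]big_mkcond; apply: eq_bigr => h _.
  rewrite (reindex_inj (addrI (h *m T))) /=.
  under eq_bigr do rewrite memH.
  by case: (h \in U) => /=; [rewrite [RHS]big_mkcond | rewrite big1].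
have cardH : #|H|%:R = #|F|%:R * #|U|%:R :> R.
  rewrite -[#|H|]sum1_card natr_sum sumH -natrM -sum_nat_const natr_sum.
  by apply: eq_bigr => xi _; rewrite -natr_sum sum1_card.
have Uadd : add_closed [set (x, x *m T) | x in U].
  split; first by apply/imsetP; exists 0; rewrite ?mul0mx //; apply/imsetP; exists 0.
  move=> _ _ /imsetP[x xU ->] /imsetP[y yU ->]; apply/imsetP; exists (x + y).
    by apply/imsetP; exists ((x, x *m T) + (y, y *m T)); rewrite // HD ?UP.
  by rewrite mulmxDl.
have im (P : 'rV['F_p]_N * 'rV['F_p]_N -> R) :
    \sum_(z in [set (x, x *m T) | x in U]) P z = \sum_(x in U) P (x, x *m T).
  by rewrite big_imset // => x y _ _ [].
have up : \sum_(z in H) wigner e f z <= #|F|%:R * G.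
  rewrite sumH; apply: sum_le_card => xi _.
  have := sum_wigner_translate_le he f (0, xi) Uadd.
  rewrite !im; apply: le_trans; rewrite le_eqVlt; apply/orP; left; apply/eqP.
  apply: eq_bigr => h _.
  by rewrite -[_ + _ in RHS]/(0 + h, xi + h *m T) add0r addrC.
have Ubig : c * q <= #|U|%:R.
  apply: le_trans Hbig _; rewrite sumH exchange_big /= -[leRHS]mulr1.
  apply: sum_le_card => h _; apply: le_trans (sum_wigner_snd_le1 he f1 h).
  rewrite [leRHS](reindex_inj (addrI (h *m T))) /= [leRHS](bigID (mem F)) /= lerDl.
  by apply: sumr_ge0 => xi _; apply: wigner_ge0.
have G0 : 0 <= G by apply: sumr_ge0 => h _; apply: wigner_ge0.
apply: (@le_trans _ _ G); last first.
  by rewrite [leRHS](bigID (mem U)) /= lerDl sumr_ge0 // => h _; apply: wigner_ge0.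
have F0 : 0 <= #|F|%:R :> R by apply: ler0n.
move: Hle (le_trans Hbig up) Ubig; rewrite cardH.
move: (#|F|%:R) (#|U|%:R) F0 => x y x0 xy xG cy.
have xc : x * c <= K.
  rewrite -(ler_pM2r q0) -mulrA; apply: le_trans xy; exact: ler_wpM2l.
rewrite mulrAC ler_pdivrMr // expr2 -mulrA.
apply: (@le_trans _ _ (c * (x * G))); first by rewrite ler_pM2l.
have -> : c * (x * G) = x * c * G by ring.
by rewrite [leRHS]mulrC ler_wpM2r.
Qed.

End LinearGraph.

(** * Symmetry of the linear map and correlation with a quadratic phase *)

Section Radical.
Variables (R : archiRcfType) (p : nat) (e : 'F_p -> R[i]) (he : additive_character e).

(* Substituting [h = z - x - y] turns the sum into an average over [z] of
   bilinear sums with phase [x (T^T - T) y^T], and Cauchy-Schwarz bounds each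
   of those by the size of the radical. *)
Lemma card_radical_ge N (f : 'rV['F_p]_N -> R[i]) (T : 'M['F_p]_N) (c : R)
    (q := #|{: 'rV['F_p]_N}|%:R : R) :
  (forall x, sqn (f x) <= 1) -> 0 < c ->
  c * q <= \sum_h wigner e f (h, h *m T) ->
  c ^+ 2 * q <= #|[set x : 'rV['F_p]_N | x *m (T^T - T) == 0]|%:R.
Proof.
move=> f1 c0; have q0 : 0 < q by apply: card_gt0.
set S := \sum_h _ => hS; set rad := [set _ | _].
pose B (x y : 'rV['F_p]_N) : 'F_p := dot (x *m T) y.
pose F z x := conj (f x) * conj (f (z - x)) * e (- B z x + B x x).
pose G z y := f (z - y) * f y * e (B z y - B y y).
pose om x y := B y x - B x y.
have omE x y : om x y = dot y (x *m (T^T - T)).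
  by rewrite /om /B dot_mulmx mulmxBr dotBr [dot (x *m T) y]dotC.
have E : (q ^+ 2 * S)%:C = \sum_z \sum_y G z y * \sum_x F z x * e (om x y).
  transitivity (\sum_x \sum_y \sum_h f (x + h) * conj (f x) * conj (f (y + h)) * f y
      * e (- B h x + B h y)).
    transitivity (\sum_h (sqn (corr e f h (h *m T)))%:C).
      rewrite rmorphM rmorph_sum mulr_sumr; apply: eq_bigr => h _.
      by rewrite -rmorphM /wigner /= mulrC divfK // expf_neq0 // lt0r_neq0.
    rewrite [RHS](eq_bigr (fun x => \sum_h \sum_y f (x + h) * conj (f x)
      * conj (f (y + h)) * f y * e (- B h x + B h y))); last first.
      by move=> x _; rewrite exchange_big.
    rewrite [RHS]exchange_big /=; apply: eq_bigr => h _.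
    rewrite sqnE /corr /ft rmorph_sum mulr_suml; apply: eq_bigr => x _.
    rewrite mulr_sumr; apply: eq_bigr => y _.
    rewrite !rmorphM /= conjCK -(charN he) opprK (charD he) /B; ring.
  rewrite [RHS](eq_bigr (fun z => \sum_y \sum_x G z y * (F z x * e (om x y))));
    last by move=> z _; apply: eq_bigr => y _; rewrite mulr_sumr.
  rewrite [RHS](eq_bigr (fun z => \sum_x \sum_y G z y * (F z x * e (om x y))));
    last by move=> z _; rewrite exchange_big.
  rewrite [RHS]exchange_big /=; apply: eq_bigr => x _.
  rewrite [RHS]exchange_big /=; apply: eq_bigr => y _.
  rewrite (reindex_inj (addIr (- (x + y)))) /=; apply: eq_bigr => z _.
  have -> : x + (z - (x + y)) = z - y by rewrite opprD addrCA addNKr.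
  have -> : y + (z - (x + y)) = z - x by rewrite [x + y]addrC opprD addrCA addNKr.
  rewrite /F /G /om.
  have -> : - B (z - (x + y)) x + B (z - (x + y)) y =
     (- B z x + B x x) + (B z y - B y y) + (B y x - B x y).
    rewrite /B mulmxBl mulmxDl !dotBl !dotDl; ring.
  rewrite !(charD he); ring.
(* Once the square is opened, the sum over [y] is [q] if [x - x'] lies in the radical and [0]
   otherwise. *)
have sqnB z : \sum_y sqn (\sum_x F z x * e (om x y)) <= q * (q * #|rad|%:R).
  rewrite -lecR rmorph_sum /= -[leLHS]ger0_norm; last first.
    by apply: sumr_ge0 => y _; rewrite lecR sqn_ge0.
  have -> : \sum_y (sqn (\sum_x F z x * e (om x y)))%:C =
      \sum_x \sum_x' F z x * conj (F z x') * \sum_y e (dot y ((x - x') *m (T^T - T))).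
    rewrite (eq_bigr (fun y => \sum_x \sum_x' F z x * conj (F z x') *
        e (dot y ((x - x') *m (T^T - T))))); last first.
      move=> y _; rewrite sqnE rmorph_sum mulr_suml; apply: eq_bigr => x _.
      rewrite mulr_sumr; apply: eq_bigr => x' _.
      rewrite rmorphM /= -(charN he) !omE mulmxBl [in RHS]dotBr [in RHS](charD he); ring.
    rewrite exchange_big; apply: eq_bigr => x _.
    by rewrite exchange_big; apply: eq_bigr => x' _; rewrite mulr_sumr.
  have F1 x : `|F z x| <= 1.
    rewrite -(@expr_le1 _ 2) // sqr_normc -sqnE lecR.
    by rewrite /F !sqnM !sqnJ (sqn_char he) mulr1 mulr_ile1 ?sqn_ge0.
  apply: le_trans (ler_norm_sum _ _ _) _.
  apply: (@le_trans _ _ (\sum_(x : 'rV['F_p]_N) (q * #|rad|%:R)%:C)); last first.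
    by rewrite sumr_const -rmorphMn [q * (_ * _)]mulr_natl.
  apply: ler_sum => x _; apply: le_trans (ler_norm_sum _ _ _) _.
  rewrite (reindex_inj (inj_comp (addrI x) (@oppr_inj _))) /=.
  apply: (@le_trans _ _ (\sum_(t in rad) q%:C)).
    rewrite [leRHS]big_mkcond; apply: ler_sum => t _ /=.
    rewrite opprB [x + (t - x)]addrC subrK (sum_char_dot he) inE; case: ifP => _; last first.
      by rewrite mulr0 normr0.
    rewrite normrM normr_nat rmorph_nat ler_piMl ?ler0n // normrM norm_conjC.
    by rewrite mulr_ile1.
  by rewrite sumr_const -rmorphMn -[q *+ _]mulr_natr.
(* Cauchy-Schwarz over the [q^2] pairs [(z, y)], where [G z y] has modulus at most [1]. *)
have : (q ^+ 2 * S) ^+ 2 <= q ^+ 2 * (q * (q * (q * #|rad|%:R))).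
  rewrite -sqn_real E pair_big /=; apply: le_trans (sqn_sum_le _ _) _.
  have -> : #|[pred x : 'rV['F_p]_N * 'rV['F_p]_N | true && true]|%:R = q ^+ 2 :> R.
    by rewrite expr2 -natrM -card_prod; congr (_%:R); apply: eq_card.
  rewrite ler_pM2l ?exprn_gt0 //.
  apply: (@le_trans _ _ (\sum_z \sum_y sqn (\sum_x F z x * e (om x y)))).
    rewrite pair_big; apply: ler_sum => z _; rewrite sqnM ler_piMl ?sqn_ge0 //.
    by rewrite /G !sqnM (sqn_char he) mulr1 mulr_ile1 ?sqn_ge0.
  by rewrite [leRHS]mulr_natl -sumr_const; apply: ler_sum => z _.
have S2 : (c * q) ^+ 2 <= S ^+ 2.
  have cq0 : 0 <= c * q by rewrite mulr_ge0 // ltW.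
  by rewrite ler_pXn2r // nnegrE // (le_trans cq0).
move=> h; rewrite -(ler_pM2l (exprn_gt0 5 q0)).
have -> : q ^+ 5 * #|rad|%:R = q ^+ 2 * (q * (q * (q * #|rad|%:R))) by ring.
apply: le_trans h; have -> : q ^+ 5 * (c ^+ 2 * q) = q ^+ 4 * (c * q) ^+ 2 by ring.
have -> : (q ^+ 2 * S) ^+ 2 = q ^+ 4 * S ^+ 2 by ring.
by rewrite ler_pM2l ?exprn_gt0.
Qed.

End Radical.

Section QuadraticCorrelation.
Variables (R : archiRcfType) (p : nat) (e : 'F_p -> R[i]) (he : additive_character e).

Lemma Fp_two_neq0 : prime p -> odd p -> (2%:R : 'F_p) != 0.
Proof.
move=> pr_p; rewrite -(dvdn_pcharf (pchar_Fp pr_p)); apply: contraL => d2.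
by move: (dvdn_prime2 pr_p (isT : prime 2)); rewrite d2 => /esym /eqP ->.
Qed.

(** On the radical of [T^T - T], of density at least [c^2], the map [T] agrees with its
    symmetrization. The full graph is covered evenly by translates of the graph above the radical,
    none heavier than that graph itself, which therefore has mass at least [c^2 (c q)]. *)
Lemma exists_large_symmetric_graph (eta : R) : prime p -> odd p -> 0 < eta ->
  exists2 c : R, 0 < c & forall N (f : 'rV['F_p]_N -> R[i]),
    (forall x, sqn (f x) <= 1) ->
    eta * #|{: 'rV['F_p]_N}|%:R <= \sum_z wigner e f z ^+ 2 ->
    exists2 M : 'M['F_p]_N, M^T = M &
      c * #|{: 'rV['F_p]_N}|%:R <= \sum_h wigner e f (h, h *m M).
Proof.
move=> pr_p odd_p eta0; have [c c0 HT] := exists_large_graph he pr_p eta0.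
exists (c ^+ 3); first exact: exprn_gt0.
move=> N f f1 large; have [T hT] := HT N f f1 large.
have := card_radical_ge he f1 c0 hT; set q : R := _%:R in hT *; set rad := [set _ | _] => hrad.
have q0 : 0 < q by apply: card_gt0.
have two := Fp_two_neq0 pr_p odd_p.
exists (2%:R^-1 *: (T + T^T)).
  by rewrite linearZ linearD /= trmxK addrC.
have radM x : x \in rad -> x *m (2%:R^-1 *: (T + T^T)) = x *m T.
  rewrite inE mulmxBr subr_eq0 => /eqP h.
  by rewrite -scalemxAr mulmxDr h -mulr2n -scaler_nat scalerA mulVf // scale1r.
pose L := [set (x, x *m T) | x in rad].
have Ladd : add_closed L.
  split; first by apply/imsetP; exists 0; rewrite ?mul0mx // inE mul0mx.
  move=> _ _ /imsetP[x xU ->] /imsetP[y yU ->]; apply/imsetP; exists (x + y).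
    by move: xU yU; rewrite !inE mulmxDl => /eqP -> /eqP ->; rewrite addr0.
  by rewrite mulmxDl.
have im (P : 'rV['F_p]_N * 'rV['F_p]_N -> R) :
    \sum_(z in L) P z = \sum_(x in rad) P (x, x *m T).
  by rewrite big_imset // => x y _ _ [].
have avg : #|rad|%:R * \sum_h wigner e f (h, h *m T) <=
    q * \sum_(h in rad) wigner e f (h, h *m T).
  apply: (@le_trans _ _ (\sum_(a : 'rV['F_p]_N) \sum_(z in L)
    wigner e f ((a, a *m T) + z))).
    rewrite exchange_big /= im; apply: sum_ge_card => h _.
    rewrite (reindex_inj (addIr h)) /= le_eqVlt; apply/orP; left; apply/eqP.
    by apply: eq_bigr => a _; rewrite mulmxDl.
  rewrite [leRHS]mulr_natl -sumr_const; apply: ler_sum => a _; rewrite -im.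
  exact: (sum_wigner_translate_le he).
apply: (@le_trans _ _ (\sum_(h in rad) wigner e f (h, h *m T))); last first.
  rewrite (eq_bigr (fun h => wigner e f (h, h *m (2%:R^-1 *: (T + T^T))))).
    rewrite [leRHS](bigID (mem rad)) /= lerDl.
    by apply: sumr_ge0 => h _; apply: wigner_ge0.
  by move=> h /radM ->.
rewrite -(ler_pM2l q0); apply: le_trans avg.
have -> : q * (c ^+ 3 * q) = c ^+ 2 * q * (c * q) by ring.
by apply: ler_pM => //; rewrite mulr_ge0 ?exprn_ge0 // ltW.
Qed.

(** With [2 M = M0] symmetric, the quadratic form of [M] changes by [(h M0) . x] plus a constant
    when [x] moves to [x + h]. So the autocorrelation of [g] at [h] has the modulus of
    [corr f h (h M0)], and the fourth moment of [ft g] is at least [c q^4] while the second is at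
    most [q^2]. Passing from [c] to [c / 2] makes the final contradiction strict. *)
Lemma exists_quadratic_correlation (eta : R) : prime p -> odd p -> 0 < eta ->
  exists2 c : R, 0 < c & forall N (f : 'rV['F_p]_N -> R[i]),
    (forall x, sqn (f x) <= 1) ->
    eta * #|{: 'rV['F_p]_N}|%:R <= \sum_z wigner e f z ^+ 2 ->
    exists (M : 'M['F_p]_N) (xi : 'rV['F_p]_N),
      c * #|{: 'rV['F_p]_N}|%:R ^+ 2 <=
        sqn (\sum_x f x * e (- (dot (x *m M) x + dot xi x))).
Proof.
move=> pr_p odd_p eta0.
have [c c0 HM] := exists_large_symmetric_graph pr_p odd_p eta0.
exists (c / 2); first exact: divr_gt0.
move=> N f f1 large; have [M0 M0sym hM0] := HM N f f1 large.
set q : R := _%:R in hM0 *; have q0 : 0 < q by apply: card_gt0.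
have two := Fp_two_neq0 pr_p odd_p.
pose M := 2%:R^-1 *: M0; pose g x := f x * e (- dot (x *m M) x).
have Msym : M^T = M by rewrite /M linearZ /= M0sym.
have g1 x : sqn (g x) <= 1 by rewrite sqnM (sqn_char he) mulr1.
have autoE h : sqn (autocorr g h) = q ^+ 2 * wigner e f (h, h *m M0).
  rewrite /wigner /= mulrC divfK ?expf_neq0 ?lt0r_neq0 //.
  have -> : autocorr g h = e (- dot (h *m M) h) * corr e f h (h *m M0).
    rewrite /autocorr /corr /ft mulr_sumr; apply: eq_bigr => x _.
    rewrite /g rmorphM /= -(charN he) opprK.
    have -> : h *m M0 = h *m M + h *m M.
      by rewrite -mulr2n -scaler_nat -scalemxAr scalerA divff // scale1r.
    have sM y z : dot (y *m M) z = dot (z *m M) y.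
      by rewrite dot_mulmx Msym dotC.
    have -> : - dot ((x + h) *m M) (x + h) =
        - dot (h *m M) h - dot (h *m M + h *m M) x - dot (x *m M) x.
      by rewrite mulmxDl !dotDl !dotDr (sM x h); ring.
    have E : e (- dot (x *m M) x) * e (dot (x *m M) x) = 1.
      by rewrite -(charD he) addNr (char0 he).
    by rewrite !(charD he) -[RHS]mulr1 -E; ring.
  by rewrite sqnM (sqn_char he) mul1r.
have sum2 : c * q ^+ 4 <= \sum_xi sqn (ft e g xi) ^+ 2.
  rewrite (sum_sqn_ft_sq he) (eq_bigr _ (fun h _ => autoE h)) -mulr_sumr -/q.
  have -> : c * q ^+ 4 = q * (q ^+ 2 * (c * q)) by ring.
  by rewrite ler_pM2l // ler_pM2l ?exprn_gt0.
have sum1 : \sum_xi sqn (ft e g xi) <= q ^+ 2.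
  rewrite (parseval he) expr2 ler_pM2l // -[leRHS]mulr1.
  by rewrite [leRHS]mulr_natl -sumr_const; apply: ler_sum.
have [/existsP[xi hxi]|/existsPn hn] :=
    boolP [exists xi, c / 2 * q ^+ 2 <= sqn (ft e g xi)].
  exists M, xi; apply: le_trans hxi _; rewrite le_eqVlt; apply/orP; left; apply/eqP.
  congr sqn; apply: eq_bigr => x _; by rewrite /g opprD (charD he) mulrA.
exfalso; move: sum2; apply/negP; rewrite -ltNge.
apply: (@le_lt_trans _ _ (c / 2 * q ^+ 2 * q ^+ 2)); last first.
  rewrite -mulrA -exprD ltr_pM2r ?exprn_gt0 //.
  by rewrite ltr_pdivrMr // ltr_pMr // ltr1n.
apply: (@le_trans _ _ (c / 2 * q ^+ 2 * \sum_xi sqn (ft e g xi))); last first.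
  by rewrite ler_wpM2l // mulr_ge0 ?sqr_ge0 // divr_ge0 // ltW.
rewrite mulr_sumr; apply: ler_sum => xi _; rewrite expr2 ler_wpM2r ?sqn_ge0 //.
by have := hn xi; rewrite -ltNge => /ltW.
Qed.

End QuadraticCorrelation.

(** * The eighth power of the U^3 norm *)

Section U3Average.
Variable R : realType.

Lemma average_reindex (F : numFieldType) (A B : finType) (phi : B -> A) (g : A -> F) :
  bijective phi -> average g = average (g \o phi).
Proof.
move=> bij; rewrite /average (bij_eq_card bij).
by congr (_ / _); apply: reindex; apply: onW_bij.
Qed.

Lemma eq_average (F : numFieldType) (A : finType) (g h : A -> F) :
  g =1 h -> average g = average h.
Proof. by move=> gh; rewrite /average; congr (_ / _); apply: eq_bigr. Qed.

Definition cube_average (F : numFieldType) (A : finZmodType) (g : A -> F) : F :=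
  average (fun x => average (fun h1 => average (fun h2 => average (fun h3 =>
    \prod_(w1 : bool) \prod_(w2 : bool) \prod_(w3 : bool)
      g (x + h1 *+ w1 + h2 *+ w2 + h3 *+ w3))))).

Lemma average_real (A : finType) (g : A -> R) :
  average (fun x => (g x)%:C) = (average g)%:C.
Proof. by rewrite /average rmorphM fmorphV rmorph_nat rmorph_sum. Qed.

Lemma U3_normE (A : finZmodType) (g : A -> R) :
  U3_norm (fun x => (g x)%:C) = 8.-root (cube_average g)%:C.
Proof.
rewrite /U3_norm /cube_average -average_real; congr (8.-root _).
apply: eq_average => x; rewrite -average_real; apply: eq_average => h1.
rewrite -average_real; apply: eq_average => h2; rewrite -average_real.
apply: eq_average => h3; rewrite rmorph_prod; apply: eq_bigr => w1 _.
rewrite rmorph_prod; apply: eq_bigr => w2 _; rewrite rmorph_prod.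
apply: eq_bigr => w3 _; elim: (w1 + w2 + w3)%N => //= n ->; exact: conjc_real.
Qed.

Lemma U3_norm_le (A : finZmodType) (g : A -> R) (eps : R) :
  0 <= eps -> 0 <= cube_average g -> cube_average g <= eps ^+ 8 ->
  U3_norm (fun x => (g x)%:C) <= eps%:C.
Proof.
move=> e0 g0 ge; rewrite U3_normE.
have -> : eps%:C = 8.-root ((eps ^+ 8)%:C) by rewrite rmorphXn exprCK // lecR.
by rewrite ler_rootC // ?qualifE /= lecR ?exprn_ge0.
Qed.

Lemma cube_average_reindex (F : numFieldType) (A B : finZmodType) (phi : {additive B -> A})
    (g : A -> F) : bijective phi -> cube_average g = cube_average (g \o phi).
Proof.
move=> bij; rewrite /cube_average (average_reindex _ bij); apply: eq_average => x /=.
rewrite (average_reindex _ bij); apply: eq_average => h1 /=.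
rewrite (average_reindex _ bij); apply: eq_average => h2 /=.
rewrite (average_reindex _ bij); apply: eq_average => h3 /=.
do 3![apply: eq_bigr => ? _].
by rewrite !raddfD !raddfMn.
Qed.

(** For fixed [h], the sum of [W(h, xi)^2] over [xi] is a fourth moment of Fourier coefficients,
    hence the U^2 average of the derivative of [f] in direction [h]. The identity also supplies the
    nonnegativity that the eighth root requires. *)
Lemma cube_average_wigner p (e : 'F_p -> R[i]) N (f : 'rV['F_p]_N -> R) :
  additive_character e ->
  cube_average f * #|{: 'rV['F_p]_N}|%:R = \sum_z wigner e (fun x => (f x)%:C) z ^+ 2.
Proof.
move=> he; pose fC x : R[i] := (f x)%:C.
pose V := 'rV['F_p]_N; set q : R := _%:R; have q0 : 0 < q by apply: card_gt0.
have qn0 : q != 0 by rewrite lt0r_neq0.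
have -> : \sum_z wigner e fC z ^+ 2 =
    (q ^+ 4)^-1 * \sum_h \sum_xi sqn (ft e (fun x => fC (x + h) * conj (fC x)) xi) ^+ 2.
  rewrite pair_big mulr_sumr; apply: eq_bigr => -[h xi] _.
  by rewrite /wigner expr_div_n -exprM mulrC.
pose P h k x := f (x + k + h) * f (x + k) * (f (x + h) * f x).
have sqE h : \sum_xi sqn (ft e (fun x => fC (x + h) * conj (fC x)) xi) ^+ 2 =
    q * \sum_k (\sum_x P h k x) ^+ 2.
  rewrite (sum_sqn_ft_sq he); congr (_ * _); apply: eq_bigr => k _.
  rewrite -sqn_real; congr sqn; rewrite /autocorr rmorph_sum; apply: eq_bigr => x _.
  have cr y : conj (fC y) = fC y by exact: conjc_real.
  by rewrite rmorphM /= !cr /fC -!rmorphM.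
rewrite (eq_bigr _ (fun h _ => sqE h)) -mulr_sumr.
have -> : cube_average f = (q ^+ 4)^-1 * \sum_x \sum_h \sum_k \sum_l P h k x * P h k (x + l).
  have avE (g : V -> R) : average g = q^-1 * \sum_x g x by rewrite /average mulrC.
  have -> : (q ^+ 4)^-1 = q^-1 * (q^-1 * (q^-1 * q^-1)) by field.
  rewrite /cube_average avE -!mulrA; congr (_ * _).
  rewrite mulr_sumr mulr_sumr mulr_sumr; apply: eq_bigr => x _.
  rewrite avE; congr (_ * _); rewrite !mulr_sumr; apply: eq_bigr => h _.
  rewrite avE; congr (_ * _); rewrite !mulr_sumr; apply: eq_bigr => k _.
  rewrite avE; congr (_ * _); apply: eq_bigr => l _.
  rewrite !big_bool /= !mulr1n !mulr0n !addr0 /P.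
  have -> : x + h + k = x + k + h by rewrite addrAC.
  have -> : x + l + k + h = x + k + h + l by rewrite -!addrA [l + _]addrC -!addrA.
  have -> : x + l + k = x + k + l by rewrite addrAC.
  have -> : x + l + h = x + h + l by rewrite addrAC.
  ring.
have -> : \sum_x \sum_h \sum_k \sum_l P h k x * P h k (x + l) =
    \sum_h \sum_k (\sum_x P h k x) ^+ 2.
  rewrite exchange_big; apply: eq_bigr => h _; rewrite exchange_big.
  apply: eq_bigr => k _; rewrite expr2 mulr_suml; apply: eq_bigr => x _.
  by rewrite mulr_sumr [RHS](reindex_inj (addrI x)).
by rewrite -mulrA [_ * q]mulrC.
Qed.

Lemma cube_average_ge0 k n p (f : 'M['F_p]_(k, n) -> R) :
  prime p -> 0 <= cube_average f.
Proof.
move=> pr_p; have [e he] := exists_character R pr_p.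
have bij : bijective (@vec_mx 'F_p k n).
  by exists mxvec; [exact: vec_mxK | exact: mxvecK].
rewrite (cube_average_reindex _ bij).
rewrite -(pmulr_lge0 _ (card_gt0 R p (k * n))) (cube_average_wigner _ he).
by apply: sumr_ge0 => z _; apply: sqr_ge0.
Qed.

End U3Average.

(** * Conditional expectation and energy *)

Section FiberMean.
Variables (T : finType) (U : eqType).

(** [cond_exp] for an arbitrary map. The field is general because the energy increment also takes
    means of complex-valued functions. *)
Definition fiber_mean (K : numFieldType) (F : T -> U) (f : T -> K) x : K :=
  (\sum_(y | F y == F x) f y) / #|[pred y | F y == F x]|%:R.

Section NumField.
Variables (K : numFieldType) (F : T -> U).
Implicit Types (f g : T -> K).

Lemma card_fiber_gt0 x : 0 < #|[pred y | F y == F x]|%:R :> K.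
Proof. by rewrite ltr0n; apply/card_gt0P; exists x; rewrite inE. Qed.

Lemma fiber_mean_eq f x y : F x = F y -> fiber_mean F f x = fiber_mean F f y.
Proof. by rewrite /fiber_mean => ->. Qed.

Lemma sum_fiber_mean_mul f g : (forall x y, F x = F y -> g x = g y) ->
  \sum_x fiber_mean F f x * g x = \sum_x f x * g x.
Proof.
move=> gF; pose n x : K := #|[pred y | F y == F x]|%:R.
transitivity (\sum_x \sum_y (if F y == F x then f y * (g x / n x) else 0)).
  apply: eq_bigr => x _; rewrite -big_mkcond -mulr_suml /fiber_mean /= -/(n x).
  by rewrite mulrAC mulrA.
rewrite exchange_big; apply: eq_bigr => y _ /=.
rewrite -big_mkcond /= (eq_bigr (fun=> f y * (g y / n y))) => [|x /eqP e]; last first.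
  by rewrite /n (gF _ _ e) e.
rewrite sumr_const -mulr_natl mulrCA; congr (_ * _).
have -> : #|[pred x | F y == F x]|%:R = n y.
  by rewrite /n; congr (_%:R); apply: eq_card => x; rewrite !inE eq_sym.
by rewrite mulrC divfK // lt0r_neq0 // card_fiber_gt0.
Qed.

Lemma fiber_mean_bounds f (a b : K) :
  (forall x, a <= f x <= b) -> forall x, a <= fiber_mean F f x <= b.
Proof.
move=> fab x; rewrite /fiber_mean ler_pdivlMr ?card_fiber_gt0 //.
rewrite ler_pdivrMr ?card_fiber_gt0 // !mulr_natr -!sumr_const.
by apply/andP; split; apply: ler_sum => y _; case/andP: (fab y).
Qed.

End NumField.
End FiberMean.

Section Energy.
Variables (R : realType) (T : finType).
Implicit Types (f : T -> R).

Definition energy (U : eqType) (F : T -> U) f : R :=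
  (\sum_x fiber_mean F f x ^+ 2) / #|T|%:R.

Lemma energy_le1 (U : eqType) (F : T -> U) f :
  (forall x, 0 <= f x <= 1) -> energy F f <= 1.
Proof.
move=> f01; rewrite /energy; have [T0|T0] := posnP #|T|.
  by rewrite T0 invr0 mulr0.
rewrite ler_pdivrMr ?ltr0n // mul1r -[leRHS](sumr_const predT).
apply: ler_sum => x _; have /andP[h0 h1] := fiber_mean_bounds F f01 x.
by rewrite expr_le1.
Qed.

Section Refinement.
Variables (U U' : eqType) (F : T -> U) (F' : T -> U').
Hypothesis finerF : forall x y, F' x = F' y -> F x = F y.

(** Pythagoras: the coarser mean is the orthogonal projection of the finer one. *)
Lemma sum_sqr_fiber_mean_sub f :
  (\sum_x (fiber_mean F' f x - fiber_mean F f x) ^+ 2) / #|T|%:R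
  = energy F' f - energy F f.
Proof.
rewrite /energy -mulrBl; congr (_ / _).
have E1 : \sum_x fiber_mean F' f x * fiber_mean F f x = \sum_x f x * fiber_mean F f x.
  by apply: sum_fiber_mean_mul => x y /finerF /fiber_mean_eq.
have E2 : \sum_x fiber_mean F f x ^+ 2 = \sum_x f x * fiber_mean F f x.
  transitivity (\sum_x fiber_mean F f x * fiber_mean F f x) => //.
  by apply: sum_fiber_mean_mul => x y; apply: fiber_mean_eq.
rewrite (eq_bigr (fun x => fiber_mean F' f x ^+ 2 + fiber_mean F f x ^+ 2
  - 2 * (fiber_mean F' f x * fiber_mean F f x))); last by move=> x _; ring.
rewrite sumrB big_split -mulr_sumr E1 -E2 /=; ring.
Qed.

Lemma energy_mono f : energy F f <= energy F' f.
Proof.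
rewrite -subr_ge0 -sum_sqr_fiber_mean_sub divr_ge0 //.
by apply: sumr_ge0 => x _; apply: sqr_ge0.
Qed.

(** Against [g], which is constant on the fibres of [F'], the function [f] may be replaced by its
    mean over them. Cauchy-Schwarz and Pythagoras then leave the difference of energies. *)
Lemma energy_increment f (g : T -> R[i]) :
  (forall x y, F' x = F' y -> g x = g y) -> (forall x, sqn (g x) <= 1) ->
  sqn (\sum_x (f x - fiber_mean F f x)%:C * g x)
    <= #|T|%:R ^+ 2 * (energy F' f - energy F f).
Proof.
move=> gF g1; have [T0|T0] := posnP #|T|.
  rewrite T0 big1 => [|x _]; last by move: T0; rewrite (cardD1 x).
  by rewrite /sqn /= !expr0n addr0 mul0r.
have mC (V : eqType) (H : T -> V) x :
    (fiber_mean H f x)%:C = fiber_mean H (fun x => (f x)%:C) x.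
  by rewrite /fiber_mean rmorphM fmorphV rmorph_nat rmorph_sum.
have -> : \sum_x (f x - fiber_mean F f x)%:C * g x =
    \sum_x (fiber_mean F' f x - fiber_mean F f x)%:C * g x.
  rewrite [RHS](eq_bigr (fun x => fiber_mean F' (fun x => (f x)%:C) x * g x
    - (fiber_mean F f x)%:C * g x)) => [|x _]; last by rewrite rmorphB mulrBl -!mC.
  rewrite sumrB sum_fiber_mean_mul // -sumrB; apply: eq_bigr => x _.
  by rewrite rmorphB mulrBl.
apply: le_trans (sqn_sum_le _ _) _.
rewrite -sum_sqr_fiber_mean_sub expr2 -mulrA [_ * (_ / _)]mulrC divfK; last first.
  by rewrite pnatr_eq0 -lt0n.
rewrite ler_wpM2l ?ler0n //; apply: ler_sum => x _.
by rewrite sqnM sqn_real ler_piMr ?sqr_ge0.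
Qed.

End Refinement.
End Energy.

(** * Quadratic factors and their refinements *)

Lemma refines_of_finer k p n d1 d2 d3 e1 e2 e3
    (B' : quad_factor p n d1 d2 d3) (B : quad_factor p n e1 e2 e3) :
  (forall X Y, factor_map k B' X = factor_map k B' Y ->
    factor_map k B X = factor_map k B Y) ->
  refines k B' B.
Proof.
move=> finer; apply: smallest_sub; first exact: smallest_sigma_algebra.
move=> _ [y _ <-].
(* A fibre of [B] is a union of fibres of [B']; enumerating the matrices by [unpickle] makes it a
   countable union. *)
pose A i := if unpickle i is Some X then
    if factor_map k B X == y then (factor_map k B' @^-1` [set factor_map k B' X])%classic
    else classical_sets.set0 else classical_sets.set0.
have -> : (factor_map k B @^-1` [set y])%classic = (\bigcup_i A i)%classic.
  apply/seteqP; split => X /=.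
    by move=> e; exists (pickle X) => //; rewrite /A pickleK e eqxx.
  by move=> [i _]; rewrite /A; case: (unpickle i) => // Y; case: eqP => // <- /finer.
apply: sigma_algebra_bigcup => i; rewrite /A; case: (unpickle i) => [X|]; last first.
  exact: sigma_algebra0.
case: ifP => _; last exact: sigma_algebra0.
by apply: sub_sigma_algebra; exists (factor_map k B' X).
Qed.

Section FactorLists.
Variables (p n : nat).

(** Lengths are data here and not type indices, so that one type holds all factors in dimension [n]
    and an iteration may change the lengths. *)
Record factor_list := FactorList {
  lins : seq 'cV['F_p]_n; syms : seq (symm p n); skews : seq (Defs.skew p n) }.

Definition complexity F := (size (lins F) + size (syms F) + size (skews F))%N.

Definition quad_of F : quad_factor p n (size (lins F)) (size (syms F)) (size (skews F)) :=
  QuadFactor (in_tuple (lins F)) (in_tuple (syms F)) (in_tuple (skews F)).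

Definition join_factor F F' := FactorList (lins F ++ lins F') (syms F ++ syms F')
  (skews F ++ skews F').

Definition agree k F (X Y : 'M['F_p]_(k, n)) : Prop :=
  [/\ forall v, v \in lins F -> X *m v = Y *m v,
      forall S, S \in syms F -> X *m val S *m X^T = Y *m val S *m Y^T
    & forall A, A \in skews F -> X *m val A *m X^T = Y *m val A *m Y^T].

Lemma factor_map_eq_iff k d1 d2 d3 (B : quad_factor p n d1 d2 d3) (X Y : 'M_(k, n)) :
  factor_map k B X = factor_map k B Y <->
  agree (FactorList (linear_part B) (symm_part B) (skew_part B)) X Y.
Proof.
split=> [E|[h1 h2 h3]].
  split=> v /tnthP[i ->].
  - by have := congr1 (fun t => tnth t.1.1 i) E; rewrite !tnth_mktuple.
  - by have := congr1 (fun t => val (tnth t.1.2 i)) E; rewrite !tnth_mktuple.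
  - by have := congr1 (fun t => val (tnth t.2 i)) E; rewrite !tnth_mktuple.
congr (_, _, _); apply: eq_from_tnth => i; rewrite !tnth_mktuple.
- by apply: h1; rewrite mem_tnth.
- by apply: val_inj; apply: h2; rewrite mem_tnth.
- by apply: val_inj; apply: h3; rewrite mem_tnth.
Qed.

Lemma agree_join k F F' (X Y : 'M_(k, n)) :
  agree (join_factor F F') X Y <-> agree F X Y /\ agree F' X Y.
Proof.
split=> [[h1 h2 h3]|[[h1 h2 h3] [g1 g2 g3]]].
  by split; split=> v vF; [apply: h1|apply: h2|apply: h3|apply: h1|apply: h2|apply: h3];
    rewrite mem_cat vF ?orbT.
split=> v; rewrite mem_cat => /orP[].
- exact: h1.
- exact: g1.
- exact: h2.
- exact: g2.
- exact: h3.
- exact: g3.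
Qed.

Lemma complexity_join F F' :
  complexity (join_factor F F') = (complexity F + complexity F')%N.
Proof.
have E a b c a' b' c' : (a + a' + (b + b') + (c + c') = a + b + c + (a' + b' + c'))%N.
  by lia.
rewrite -E; case: F F' => [l s a] [l' s' a'].
by congr (_ + _ + _)%N; apply: size_cat.
Qed.

Definition finer k F' F := forall X Y : 'M['F_p]_(k, n), agree F' X Y -> agree F X Y.

Lemma finer_trans k F1 F2 F3 : finer k F1 F2 -> finer k F2 F3 -> finer k F1 F3.
Proof. by move=> h12 h23 X Y /h12 /h23. Qed.

Lemma symm_half_proof (Q : 'M['F_p]_n) : 2%:R^-1 *: (Q + Q^T) \is symmetricmx.
Proof.
apply/is_hermitianmxP; rewrite expr0 scale1r map_mx_id //.
by rewrite [RHS]linearZ /= [(_ + _)^T]linearD /= trmxK addrC.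
Qed.

Lemma skew_half_proof (Q : 'M['F_p]_n) : 2%:R^-1 *: (Q - Q^T) \is skewmx.
Proof.
apply/is_hermitianmxP; rewrite expr1 scaleN1r map_mx_id //.
by rewrite [(_ *: _)^T]linearZ /= [(_ - _)^T]linearB /= trmxK -scalerN opprB.
Qed.

Definition symm_half Q : symm p n := Sub (2%:R^-1 *: (Q + Q^T)) (symm_half_proof Q).
Definition skew_half Q : Defs.skew p n := Sub (2%:R^-1 *: (Q - Q^T)) (skew_half_proof Q).

Hypotheses (pr_p : prime p) (odd_p : odd p).

Lemma add_halves Q : val (symm_half Q) + val (skew_half Q) = Q.
Proof.
rewrite /= -scalerDr addrACA subrr addr0 -mulr2n -scaler_nat scalerA mulVf ?scale1r //.
exact: Fp_two_neq0.
Qed.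

Lemma symm_tr (S : symm p n) : (val S)^T = val S.
Proof.
by have /is_hermitianmxP := valP S; rewrite expr0 scale1r map_mx_id.
Qed.

Lemma skew_tr (A : Defs.skew p n) : (val A)^T = - val A.
Proof.
have /is_hermitianmxP := valP A; rewrite expr1 scaleN1r map_mx_id // => {2}->.
by rewrite opprK.
Qed.

Lemma sum_mxvec_index k (G : 'I_(k * n) -> 'F_p) :
  \sum_i G i = \sum_(i < k) \sum_(a < n) G (mxvec_index i a).
Proof.
rewrite pair_big /= (reindex _ (curry_mxvec_bij _ _)) /=.
by apply: eq_bigr => -[].
Qed.

(** The factor takes one vector for each row of [X], and for each ordered pair of rows the symmetric
    and the skew half of the corresponding block of [M]. *)
Lemma exists_factor_of_phase k (M : 'M['F_p]_(k * n)) (xi : 'rV_(k * n)) :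
  exists2 F : factor_list, complexity F = (k + 2 * (k * k))%N &
    forall X Y : 'M_(k, n), agree F X Y ->
      dot (mxvec X *m M) (mxvec X) + dot xi (mxvec X) =
      dot (mxvec Y *m M) (mxvec Y) + dot xi (mxvec Y).
Proof.
pose blk (ij : 'I_k * 'I_k) : 'M['F_p]_n :=
  \matrix_(a, b) M (mxvec_index ij.1 a) (mxvec_index ij.2 b).
pose c i : 'cV['F_p]_n := \col_a xi 0 (mxvec_index i a).
exists (FactorList [seq c i | i : 'I_k] [seq symm_half (blk ij) | ij : 'I_k * 'I_k]
    [seq skew_half (blk ij) | ij : 'I_k * 'I_k]).
  by rewrite /complexity /= !size_image card_prod card_ord -addnA addnn mul2n.
have E X : dot (mxvec X *m M) (mxvec X) + dot xi (mxvec X) =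
    \sum_(i < k) \sum_(j < k) (X *m blk (i, j) *m X^T) i j + \sum_i (X *m c i) i 0.
  congr (_ + _).
    rewrite exchange_big /dot mxE sum_mxvec_index /=; apply: eq_bigr => j _.
    rewrite (eq_bigr (fun b => \sum_(i < k) \sum_(a < n)
      X i a * blk (i, j) a b * X j b)) => [|b _].
      rewrite exchange_big /=; apply: eq_bigr => i _; rewrite mxE.
      by apply: eq_bigr => b _; rewrite !mxE mulr_suml.
    rewrite mxE sum_mxvec_index mxE mxvecE mulr_suml; apply: eq_bigr => i _.
    by rewrite mulr_suml; apply: eq_bigr => a _; rewrite mxvecE mxE.
  rewrite dotC /dot mxE sum_mxvec_index; apply: eq_bigr => i _.
  by rewrite mxE; apply: eq_bigr => a _; rewrite mxvecE !mxE.
move=> X Y [h1 h2 h3]; rewrite !E; congr (_ + _).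
  apply: eq_bigr => i _; apply: eq_bigr => j _.
  have split_blk Z : Z *m blk (i, j) *m Z^T =
      Z *m val (symm_half (blk (i, j))) *m Z^T + Z *m val (skew_half (blk (i, j))) *m Z^T.
    by rewrite -mulmxDl -mulmxDr add_halves.
  suff -> : X *m blk (i, j) *m X^T = Y *m blk (i, j) *m Y^T by [].
  have symM : symm_half (blk (i, j)) \in [seq symm_half (blk ij) | ij : 'I_k * 'I_k].
    by apply/mapP; exists (i, j); rewrite ?mem_enum.
  have skewM : skew_half (blk (i, j)) \in [seq skew_half (blk ij) | ij : 'I_k * 'I_k].
    by apply/mapP; exists (i, j); rewrite ?mem_enum.
  by rewrite !split_blk (h2 _ symM) (h3 _ skewM).
by apply: eq_bigr => i _; rewrite h1 //; apply/mapP; exists i; rewrite ?mem_enum.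
Qed.

End FactorLists.

(** * Trading low-rank combinations for vectors *)

Section HighRank.
Variables (R : realType) (p : nat).
Hypotheses (pr_p : prime p) (odd_p : odd p).

Lemma exists_independent n (F : factor_list p n) :
  exists F' : factor_list p n, [/\ free (lins F'), syms F' = syms F, skews F' = skews F,
    (size (lins F') <= size (lins F))%N & forall k, finer k F' F].
Proof.
exists (FactorList (vbasis <<lins F>>%VS) (syms F) (skews F)); split => //=.
- exact/basis_free/vbasisP.
- by rewrite size_tuple dim_span.
move=> k X Y [h1 h2 h3]; split; [move=> v vF|exact: h2|exact: h3].
have /coord_vbasis -> : v \in <<lins F>>%VS by apply: memv_span.
rewrite !mulmx_sumr; apply: eq_bigr => i _; rewrite -!scalemxAr; congr (_ *: _).
by apply: h1 => /=; rewrite mem_nth // size_tuple.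
Qed.

(** Row and column space of [S] correspond under transposition, so [S = P^T D P] with the rows of
    [P] a basis. Taking [c = 1] or [c = -1] covers symmetric and skew matrices at once. *)
Lemma congr_row_base k n (S : 'M['F_p]_n) (c : 'F_p) (X Y : 'M_(k, n)) :
  S^T = c *: S -> c * c = 1 ->
  X *m (row_base S)^T = Y *m (row_base S)^T -> X *m S *m X^T = Y *m S *m Y^T.
Proof.
move=> ST cc; set P := row_base S => XP.
have /submxP[U SU] : (S <= P)%MS by rewrite eq_row_base.
have SE : S = P^T *m (c *: (U^T *m pinvmx P)) *m P.
  have -> : P^T *m (c *: (U^T *m pinvmx P)) *m P = S *m pinvmx P *m P.
    have -> : S *m pinvmx P = c *: (P^T *m (U^T *m pinvmx P)).
      rewrite mulmxA -trmx_mul -SU ST -scalemxAl scalerA cc scale1r.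
      by [].
    by rewrite -scalemxAr.
  by rewrite mulmxKpV // eq_row_base.
have congrE (Z : 'M_(k, n)) : Z *m S *m Z^T =
    (Z *m P^T) *m (c *: (U^T *m pinvmx P)) *m (Z *m P^T)^T.
  by rewrite [(Z *m P^T)^T]trmx_mul trmxK {1}SE !mulmxA.
by rewrite !congrE XP.
Qed.

Lemma congr_isolate k n d (G : 'I_d -> 'M['F_p]_n) (a : 'I_d -> 'F_p) i (X Y : 'M_(k, n)) :
  a i != 0 ->
  X *m (\sum_j a j *: G j) *m X^T = Y *m (\sum_j a j *: G j) *m Y^T ->
  (forall j, j != i -> X *m G j *m X^T = Y *m G j *m Y^T) ->
  X *m G i *m X^T = Y *m G i *m Y^T.
Proof.
move=> ai0 + hj.
have lin (Z : 'M_(k, n)) :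
    Z *m (\sum_j a j *: G j) *m Z^T = \sum_j a j *: (Z *m G j *m Z^T).
  rewrite mulmx_sumr mulmx_suml; apply: eq_bigr => j _.
  by rewrite -scalemxAr -scalemxAl.
rewrite !lin (bigD1 i) //= [RHS](bigD1 i) //=.
rewrite [X in _ + X = _](eq_bigr (fun j => a j *: (Y *m G j *m Y^T))); last first.
  by move=> j /hj ->.
by move=> /addIr /(scalerI ai0).
Qed.

(** [S] and [A] are half the sum and half the difference of [S + A] and its transpose. *)
Lemma rank_symm_skew_le n (S A : 'M['F_p]_n) : S^T = S -> A^T = - A ->
  (\rank S <= 2 * \rank (S + A)%R)%N /\ (\rank A <= 2 * \rank (S + A)%R)%N.
Proof.
move=> ST AT; have two := Fp_two_neq0 pr_p odd_p.
have half (B : 'M['F_p]_n) : 2%:R^-1 *: (B + B) = B.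
  by rewrite -mulr2n -scaler_nat scalerA mulVf ?scale1r.
have rkQ : \rank (S - A)%R = \rank (S + A)%R.
  have <- : (S + A)^T = S - A by rewrite raddfD /= ST AT.
  by rewrite mxrank_tr.
split.
  have -> : \rank S = \rank (2%:R^-1 *: ((S + A) + (S - A))).
    by rewrite addrACA subrr addr0 half.
  rewrite (leq_trans (mxrank_scale _ _)) // (leq_trans (mxrank_add _ _)) //.
  by rewrite rkQ addnn mul2n.
have -> : \rank A = \rank (2%:R^-1 *: ((S + A) - (S - A))).
  by rewrite opprB [A - S]addrC addrACA subrr add0r half.
rewrite (leq_trans (mxrank_scale _ _)) // (leq_trans (mxrank_add _ _)) //.
by rewrite mxrank_opp rkQ addnn mul2n.
Qed.

(* A matrix occurring in a low-rank combination is recovered from the other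
   matrices and from the products of [X] with a basis of the row space of the
   symmetric (or skew) part of that combination. *)
Lemma exists_rank_reduction n (F : factor_list p n)
    (a : 'I_(size (syms F)) -> 'F_p) (b : 'I_(size (skews F)) -> 'F_p) :
  ~ ((forall i, a i = 0) /\ (forall j, b j = 0)) ->
  let Q := \sum_i a i *: val (tnth (in_tuple (syms F)) i) +
           \sum_j b j *: val (tnth (in_tuple (skews F)) j) in
  exists F' : factor_list p n,
    [/\ (size (syms F') + size (skews F') < size (syms F) + size (skews F))%N,
        (complexity F' <= complexity F + 2 * \rank Q)%N & forall k, finer k F' F].
Proof.
move=> ab0; set S := (X in X + _); set A := (X in _ + X) => Q.
have ST : S^T = S.
  by rewrite linear_sum /=; apply: eq_bigr => i _; rewrite linearZ /= symm_tr.
have AT : A^T = - A.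
  rewrite linear_sum /= -sumrN; apply: eq_bigr => i _.
  by rewrite linearZ /= skew_tr scalerN.
have [rkS rkA] := rank_symm_skew_le ST AT.
have rowsP (Z : 'M['F_p]_n) k (X Y : 'M_(k, n)) :
    (forall v, v \in [seq (row l (row_base Z))^T | l : 'I_(\rank Z)] ->
      X *m v = Y *m v) -> X *m (row_base Z)^T = Y *m (row_base Z)^T.
  move=> h; apply/matrixP => i l.
  have /h : (row l (row_base Z))^T \in [seq (row l (row_base Z))^T | l : 'I_(\rank Z)].
    by apply/mapP; exists l; rewrite ?mem_enum.
  by rewrite tr_row colE !mulmxA -!colE => /colP/(_ i); rewrite !mxE.
have szl (Z : 'M['F_p]_n) :
    size (lins F ++ [seq (row l (row_base Z))^T | l : 'I_(\rank Z)]) =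
    (size (lins F) + \rank Z)%N.
  by rewrite size_cat size_image card_ord.
have cplx L r l s s' t : (L = l + r -> s' = s.-1 -> r <= 2 * \rank Q ->
    L + s' + t <= l + s + t + 2 * \rank Q)%N by lia.
have cplx' L r l s t t' : (L = l + r -> t' = t.-1 -> r <= 2 * \rank Q ->
    L + s + t' <= l + s + t + 2 * \rank Q)%N by lia.
(* A symmetric matrix with nonzero coefficient is eliminated through [S]; if there is none, a skew
   one through [A]. *)
have [/existsP[i ai0]|/existsPn a0] := boolP [exists i, a i != 0].
  have szs : size [seq tnth (in_tuple (syms F)) j | j in predC1 i] = (size (syms F)).-1.
    by rewrite size_image cardC1 card_ord.
  exists (FactorList (lins F ++ [seq (row l (row_base S))^T | l : 'I_(\rank S)])
    [seq tnth (in_tuple (syms F)) j | j in predC1 i] (skews F)); split.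
  - by rewrite /= ltn_add2r size_image cardC1 card_ord ltn_predL (leq_ltn_trans _ (ltn_ord i)).
  - exact: (cplx _ _ _ _ _ (size (skews F)) (szl S) szs rkS).
  move=> k X Y [h1 h2 h3]; split; last exact: h3.
    by move=> v vF; apply: h1; rewrite mem_cat vF.
  move=> M /(tnthP (in_tuple (syms F)))[i' ->].
  have hne j : j != i -> X *m val (tnth (in_tuple (syms F)) j) *m X^T =
      Y *m val (tnth (in_tuple (syms F)) j) *m Y^T.
    by move=> ji; apply: h2; apply/mapP; exists j; rewrite ?mem_enum.
  have [->|/hne//] := eqVneq i' i; apply: (congr_isolate ai0 _ hne).
  apply: (congr_row_base (c := 1)); rewrite ?scale1r ?mulr1 //.
  by apply: rowsP => v vS; apply: h1; rewrite mem_cat vS orbT.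
have [/existsP[i bi0]|/existsPn b0] := boolP [exists i, b i != 0]; last first.
  by case: ab0; split=> i; apply/eqP; [have := a0 i|have := b0 i]; rewrite negbK.
have szk : size [seq tnth (in_tuple (skews F)) j | j in predC1 i] = (size (skews F)).-1.
  by rewrite size_image cardC1 card_ord.
exists (FactorList (lins F ++ [seq (row l (row_base A))^T | l : 'I_(\rank A)])
  (syms F) [seq tnth (in_tuple (skews F)) j | j in predC1 i]); split.
- by rewrite /= ltn_add2l size_image cardC1 card_ord ltn_predL (leq_ltn_trans _ (ltn_ord i)).
- exact: (cplx' _ _ _ (size (syms F)) _ _ (szl A) szk rkA).
move=> k X Y [h1 h2 h3]; split; [|exact: h2|].
  by move=> v vF; apply: h1; rewrite mem_cat vF.
move=> M /(tnthP (in_tuple (skews F)))[i' ->].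
have hne j : j != i -> X *m val (tnth (in_tuple (skews F)) j) *m X^T =
    Y *m val (tnth (in_tuple (skews F)) j) *m Y^T.
  by move=> ji; apply: h3; apply/mapP; exists j; rewrite ?mem_enum.
have [->|/hne//] := eqVneq i' i; apply: (congr_isolate bi0 _ hne).
apply: (congr_row_base (c := -1)); rewrite ?scaleN1r ?mulrNN ?mulr1 //.
by apply: rowsP => v vS; apply: h1; rewrite mem_cat vS orbT.
Qed.

(** The induction is on the number of matrices: each reduction lowers it, although the complexity,
    and with it the required rank, may grow. *)
Lemma exists_high_rank (omega : nat -> R) m D :
  exists D', forall n (F : factor_list p n),
    (size (syms F) + size (skews F) <= m)%N -> (complexity F <= D)%N ->
    exists F' : factor_list p n, [/\ (complexity F' <= D')%N, forall k, finer k F' F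
      & factor_rank_ge (quad_of F') (omega (complexity F'))].
Proof.
elim: m D => [|m IHm] D.
  exists D => n F; rewrite leqn0 addn_eq0 => /andP[/eqP s0 /eqP k0] FD.
  have [F' [fr e1 e2 le fin]] := exists_independent F.
  exists F'; split => //.
    by rewrite (leq_trans _ FD) // /complexity e1 e2 !leq_add2r.
  split; first exact: fr.
  (* Without matrices there is no nontrivial combination. *)
  move=> a b ab; exfalso; apply: ab; split=> i; exfalso;
    have := leq_ltn_trans (leq0n i) (ltn_ord i).
    by rewrite e1 s0.
  by rewrite e2 k0.
(* A rank below [omega c] for some complexity [c <= D] is at most [rho], without monotonicity of
   [omega]. *)
pose rho := \max_(c < D.+1) Num.Def.truncn (omega c).
have [D' HD'] := IHm (D + 2 * rho)%N.
exists (maxn D D') => n F Fm FD.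
have [F1 [fr e1 e2 le fin]] := exists_independent F.
have F1D : (complexity F1 <= D)%N.
  by rewrite (leq_trans _ FD) // /complexity e1 e2 !leq_add2r.
have [hr|nhr] := pselect (factor_rank_ge (quad_of F1) (omega (complexity F1))).
  by exists F1; split; rewrite // leq_max F1D.
have [a [b [ab0 rk]]] : exists a b, ~ ((forall i, a i = 0) /\ (forall j, b j = 0)) /\
   (\rank (\sum_(i < size (syms F1)) a i *: val (tnth (in_tuple (syms F1)) i) +
           \sum_(j < size (skews F1)) b j *: val (tnth (in_tuple (skews F1)) j))%R)%:R
     < omega (complexity F1).
  apply: contrapT => hn; apply: nhr; split; first exact: fr.
  move=> a b ab0.
  rewrite leNgt; apply/negP => lt; apply: hn; by exists a, b.
have [F2 [lt2 c2 fin2]] := exists_rank_reduction ab0.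
have rk' : (\rank (\sum_(i < size (syms F1)) a i *: val (tnth (in_tuple (syms F1)) i) +
    \sum_(j < size (skews F1)) b j *: val (tnth (in_tuple (skews F1)) j))%R <= rho)%N.
  apply: leq_trans (leq_bigmax (Ordinal (F1D : (complexity F1 < D.+1)%N))).
  rewrite /= truncn_ge_nat; first exact: ltW.
  exact: le_trans (ler0n _ _) (ltW rk).
have [| |F3 [c3 fin3 hr3]] := HD' n F2.
- by rewrite -ltnS (leq_trans lt2) // e1 e2.
- by rewrite (leq_trans c2) // leq_add // leq_mul2l rk' orbT.
exists F3; split => //; first by rewrite leq_max c3 orbT.
by move=> k; apply: finer_trans (fin k); apply: finer_trans (fin2 k).
Qed.

End HighRank.

(** * Energy iteration and the regularity lemmas *)

(** Stated abstractly because it serves both levels of the increment. The index [i] will run over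
    all functions in all dimensions, so that [D'] depends on none of them. *)
Lemma energy_iteration (R : realType) (I : Type) (T : I -> Type)
    (le : forall i, T i -> T i -> Prop) (size : forall i, T i -> nat)
    (en : forall i, T i -> R) (valid good : forall i, T i -> Prop) (gamma : R) :
  0 < gamma ->
  (forall i (t : T i), le i t t) ->
  (forall i (t1 t2 t3 : T i), le i t1 t2 -> le i t2 t3 -> le i t1 t3) ->
  (forall i (t : T i), 0 <= en i t <= 1) ->
  (forall D, exists D', forall i (t : T i), valid i t -> (size i t <= D)%N ->
    good i t \/ exists t', [/\ valid i t', le i t' t, (size i t' <= D')%N
      & en i t + gamma <= en i t']) ->
  forall D, exists D', forall i (t : T i), valid i t -> (size i t <= D)%N ->
    exists t', [/\ valid i t', le i t' t, (size i t' <= D')%N & good i t'].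
Proof.
move=> g0 refl trans en01 step D.
(* [s] bounds the increments still possible: at [s = 0] the energy is already [1], and any increment
   would exceed it. *)
suff H s : forall D, exists D', forall i (t : T i), valid i t -> (size i t <= D)%N ->
    1 - s%:R * gamma <= en i t ->
    exists t', [/\ valid i t', le i t' t, (size i t' <= D')%N & good i t'].
  have [D' HD'] := H (Num.Def.truncn gamma^-1).+1 D; exists D' => i t vt tD.
  apply: HD' => //; have /andP[en0 _] := en01 i t; apply: le_trans en0.
  by rewrite subr_le0 -ler_pdivrMr // div1r ltW // truncnS_gt.
elim: s => [|s IHs] {}D; have [D1 HD1] := step D.
  exists D => i t vt tD e1; exists t; split => //.
  case: (HD1 i t vt tD) => // -[t' [_ _ _]]; rewrite mul0r subr0 in e1.
  by have /andP[_ e2] := en01 i t'; lra.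
have [D2 HD2] := IHs D1; exists (maxn D D2) => i t vt tD e1.
case: (HD1 i t vt tD) => [gt|[t' [vt' le' sz' en']]].
  by exists t; split; rewrite // leq_max tD.
have [|t2 [v2 le2 sz2 good2]] := HD2 i t' vt' sz'.
  by apply: le_trans en'; move: e1; rewrite -natr1; lra.
exists t2; split => //; last by rewrite leq_max sz2 orbT.
exact: trans le2 le'.
Qed.

(** In the strong lemma the accuracy depends arbitrarily on the complexity [d] of the current
    factor. Weak regularity gives one bound for each [d], and this merges those with [d <= d0]. *)
Lemma uniform_bound (P : nat -> nat -> Prop) :
  (forall d D D', (D <= D')%N -> P d D -> P d D') -> (forall d, exists D, P d D) ->
  forall d0, exists D, forall d, (d <= d0)%N -> P d D.
Proof.
move=> mono ex; elim=> [|d0 [D HD]].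
  by have [D HD] := ex 0; exists D => d; rewrite leqn0 => /eqP ->.
have [D1 HD1] := ex d0.+1; exists (maxn D D1) => d.
rewrite leq_eqVlt ltnS => /orP[/eqP ->|/HD h].
  by apply: mono HD1; rewrite leq_maxr.
by apply: mono h; rewrite leq_maxl.
Qed.

Section Regularity.
Variables (R : realType) (k p : nat).
Hypotheses (pr_p : prime p) (odd_p : odd p).

(** The dimension is bundled with the function so that this type can index the iteration, which
    makes its bounds uniform in both. *)
Record unit_function := UnitFunction {
  dimension : nat;
  fn : 'M['F_p]_(k, dimension) -> R;
  fn_bounds : forall X, 0 <= fn X <= 1 }.
Arguments fn : clear implicits.
Arguments fn_bounds : clear implicits.

Definition fiber n (F : factor_list p n) : 'M['F_p]_(k, n) -> _ := factor_map k (quad_of F).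

Lemma fiber_eq n (F : factor_list p n) X Y : fiber F X = fiber F Y <-> agree F X Y.
Proof.
by case: F => l s a; apply: factor_map_eq_iff.
Qed.

Lemma fiber_finer n (F F' : factor_list p n) : finer k F' F ->
  forall X Y, fiber F' X = fiber F' Y -> fiber F X = fiber F Y.
Proof. by move=> fin X Y /fiber_eq /fin /fiber_eq. Qed.

Definition structured (u : unit_function) (F : factor_list p (dimension u)) :=
  fiber_mean (fiber F) (fn u).

Definition factor_energy (u : unit_function) (F : factor_list p (dimension u)) : R :=
  energy (fiber F) (fn u).

Definition residual_cube_average (u : unit_function) (F : factor_list p (dimension u)) : R :=
  cube_average (fun X => fn u X - structured F X).

Lemma factor_energy_bounds u (F : factor_list p (dimension u)) : 0 <= factor_energy F <= 1.
Proof.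
rewrite energy_le1 ?andbT; last exact: fn_bounds.
by rewrite divr_ge0 // sumr_ge0 // => X _; apply: sqr_ge0.
Qed.

Lemma factor_energy_increment (eps : R) : 0 < eps ->
  exists2 c : R, 0 < c & forall u (F : factor_list p (dimension u)),
    eps < residual_cube_average F ->
    exists F', [/\ finer k F' F, complexity F' = (complexity F + (k + 2 * (k * k)))%N
      & factor_energy F + c <= factor_energy F'].
Proof.
move=> eps0; have [e he] := exists_character R pr_p.
have [c c0 Hc] := exists_quadratic_correlation he pr_p odd_p eps0.
exists c => // u F large; pose h X := fn u X - structured F X.
have bij : bijective (@vec_mx 'F_p k (dimension u)).
  by exists mxvec; [exact: vec_mxK | exact: mxvecK].
have h1 X : sqn ((h X)%:C) <= 1 :> R.
  rewrite sqn_real /h; have /andP[a0 a1] := fn_bounds u X.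
  have /andP[b0 b1] := fiber_mean_bounds (fiber F) (@fn_bounds u) X.
  rewrite -[leRHS](expr1n _ 2) -ler_sqrt ?expr1n // sqrtr_sqr sqrtr1 ler_norml.
  by rewrite /structured; apply/andP; split; lra.
have [|M [xi hM]] := Hc _ (fun x => (h (vec_mx x))%:C) (fun x => h1 _).
  rewrite -(cube_average_wigner _ he) ler_wpM2r // ltW //.
  by rewrite /residual_cube_average (cube_average_reindex _ bij) in large.
have [G Gc Gphase] := exists_factor_of_phase pr_p odd_p M xi.
have finJ : finer k (join_factor F G) F by move=> X Y /agree_join[].
exists (join_factor F G); split => //; first by rewrite complexity_join Gc.
pose ph X := e (- (dot (mxvec X *m M) (mxvec X) + dot xi (mxvec X))).
have := energy_increment (fiber_finer finJ) (fn u) (g := ph).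
rewrite -/(factor_energy F) -/(factor_energy (join_factor F G)) => inc.
have : c * #|{: 'rV['F_p]_(k * dimension u)}|%:R ^+ 2 <=
    #|{: 'M['F_p]_(k, dimension u)}|%:R ^+ 2 *
      (factor_energy (join_factor F G) - factor_energy F).
  apply: le_trans hM (le_trans _ (inc _ _)) => [|X Y|X].
  - rewrite (reindex mxvec) /=; last first.
      by apply: onW_bij; exists vec_mx; [exact: mxvecK|exact: vec_mxK].
    rewrite le_eqVlt; apply/orP; left; apply/eqP; congr sqn; apply: eq_bigr => X _.
    by rewrite mxvecK.
  - by move=> /fiber_eq /agree_join[_ /Gphase E]; rewrite /ph E.
  - by rewrite (sqn_char he).
rewrite (bij_eq_card bij) mulrC ler_pM2l ?exprn_gt0 ?card_gt0 //.
  by rewrite lerBrDl.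
by rewrite -(bij_eq_card bij); apply: card_gt0.
Qed.

Lemma weak_regularity (eps : R) (D : nat) : 0 < eps ->
  exists D', forall u (F : factor_list p (dimension u)), (complexity F <= D)%N ->
    exists F', [/\ finer k F' F, (complexity F' <= D')%N & residual_cube_average F' <= eps].
Proof.
move=> eps0; have [c c0 Hc] := factor_energy_increment eps0.
have [|||D0|D' HD'] := @energy_iteration R unit_function (fun u => factor_list p (dimension u))
  (fun u F' F => finer k F' F) (fun u F => complexity F) (@factor_energy)
  (fun _ _ => True) (fun u F => residual_cube_average F <= eps) c c0 _ _ _ _ D.
- by move=> u F X Y.
- by move=> u F1 F2 F3; apply: finer_trans.
- exact: factor_energy_bounds.
- exists (D0 + (k + 2 * (k * k)))%N => u F _ FD.
  have [le|/Hc [F' [fin cF' en']]] := leP (residual_cube_average F) eps; first by left.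
  by right; exists F'; split; rewrite // cF' leq_add2r.
by exists D' => u F FD; have [F' [_ h1 h2 h3]] := HD' u F I FD; exists F'.
Qed.

(** The outer iteration runs over factors of high rank and stops when the refinement given by weak
    regularity gains little energy. The accuracy for [F'] is dictated by the complexity of [F],
    which is known before [F'] is built. *)
Lemma strong_regularity (delta : R) (omega1 omega2 : nat -> R) (D : nat) :
  0 < delta -> (forall d, 0 < omega2 d) ->
  exists D', forall u (F0 : factor_list p (dimension u)), (complexity F0 <= D)%N ->
    exists F F', [/\ finer k F F0 /\ finer k F' F, (complexity F <= D')%N,
      factor_rank_ge (quad_of F) (omega1 (complexity F)),
      residual_cube_average F' <= omega2 (complexity F)
      & factor_energy F' - factor_energy F <= delta].
Proof.
move=> delta0 omega20.
have [D1 HD1] := exists_high_rank pr_p odd_p omega1 D D.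
have [|||D0|D' HD'] := @energy_iteration R unit_function (fun u => factor_list p (dimension u))
  (fun u F' F => finer k F' F) (fun u F => complexity F) (@factor_energy)
  (fun u F => factor_rank_ge (quad_of F) (omega1 (complexity F)))
  (fun u F => exists F', [/\ finer k F' F, residual_cube_average F' <= omega2 (complexity F)
     & factor_energy F' - factor_energy F <= delta]) delta delta0 _ _ _ _ D1.
- by move=> u F X Y.
- by move=> u F1 F2 F3; apply: finer_trans.
- exact: factor_energy_bounds.
- have [D2 HD2] : exists D2, forall d, (d <= D0)%N ->
      forall u (F : factor_list p (dimension u)), (complexity F <= D0)%N ->
      exists F', [/\ finer k F' F, (complexity F' <= D2)%N
        & residual_cube_average F' <= omega2 d].
    apply: uniform_bound => [d E E' EE' h u F FD|d]; last exact: weak_regularity.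
    have [F' [h1 h2 h3]] := h u F FD; exists F'; split => //; exact: leq_trans EE'.
  have [D3 HD3] := exists_high_rank pr_p odd_p omega1 D2 D2.
  exists D3 => u F vF FD; have [F' [fin cF' res]] := HD2 _ FD u F FD.
  have [le|gt] := leP (factor_energy F' - factor_energy F) delta.
    by left; exists F'.
  (* Restoring high rank only refines [F'], so the gain of more than [delta] is kept. *)
  right; have [|F2 [c2 fin2 hr2]] := HD3 _ F' _ cF'.
    by rewrite (leq_trans _ cF') // /complexity -addnA leq_addl.
  exists F2; split => //; first exact: finer_trans fin.
  have := energy_mono (fiber_finer (fin2 k)) (fn u).
  by rewrite -/(factor_energy F') -/(factor_energy F2); lra.
exists D' => u F0 F0D; have [|F1 [c1 fin1 hr1]] := HD1 _ F0 _ F0D.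
  by rewrite (leq_trans _ F0D) // /complexity -addnA leq_addl.
have [F [vF fin cF [F' [fin' res en']]]] := HD' u F1 hr1 c1.
by exists F, F'; split => //; split => //; apply: finer_trans (fin1 k).
Qed.

End Regularity.

Lemma L2_norm_le (R : realType) (T : finType) (g : T -> R) (delta : R) :
  0 <= delta -> (\sum_x g x ^+ 2) / #|T|%:R <= delta ^+ 2 ->
  L2_norm (fun x => (g x)%:C) <= delta%:C.
Proof.
move=> d0 h; rewrite /L2_norm.
have -> : average (fun x => `|(g x)%:C| ^+ 2) = (average (fun x => g x ^+ 2))%:C.
  rewrite -average_real; apply: eq_average => x.
  by rewrite sqr_normc -[_ * _]sqnE sqn_real.
have -> : delta%:C = sqrtC ((delta ^+ 2)%:C) by rewrite rmorphXn sqrCK // lecR.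
rewrite ler_rootC ?qualifE /= ?lecR ?sqr_ge0 //.
by rewrite divr_ge0 // sumr_ge0 // => x _; apply: sqr_ge0.
Qed.

Theorem theorem3p2 (R : realType) :
  exists C : nat -> nat -> R -> (R -> R) -> (R -> R) -> nat -> nat -> nat -> nat,
  forall (k p : nat) (delta : R) (omega1 omega2 : R -> R)
         (n d1_0 d2_0 d3_0 : nat)
         (f : 'M['F_p]_(k, n) -> R) (B0 : quad_factor p n d1_0 d2_0 d3_0),
    (1 <= k)%N -> prime p -> odd p -> 0 < delta ->
    (forall x, 0 <= x -> 0 < omega1 x) ->
    (forall x, 0 <= x -> 0 < omega2 x) ->
    (forall X, 0 <= f X <= 1) ->
    exists (d1 d2 d3 : nat) (B : quad_factor p n d1 d2 d3)
           (f_str f_sml f_psr : 'M['F_p]_(k, n) -> R),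
      let c := C p k delta omega1 omega2 d1_0 d2_0 d3_0 in
      refines k B B0 /\
      (forall X, f X = f_str X + f_sml X + f_psr X) /\
      (forall X, f_str X = cond_exp f B X) /\
      L2_norm (fun X => (f_sml X)%:C) <= delta%:C /\
      U3_norm (fun X => (f_psr X)%:C) <= (1 / omega2 (d1 + d2 + d3)%:R)%:C /\
      (forall X, [/\ 0 <= f_str X <= 1, 0 <= f_str X + f_sml X <= 1,
                     -1 <= f_psr X <= 1 & -1 <= f_sml X <= 1]) /\
      (d1 <= c)%N /\ (d2 <= c)%N /\ (d3 <= c)%N /\
      factor_rank_ge B (omega1 (d1 + d2 + d3)%:R).
Proof.
(* The hypotheses stand under the existential because [C] must be a total function; where they fail,
   [c = 0] serves. *)
have bound p k delta (omega1 omega2 : R -> R) d1 d2 d3 : exists c,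
    prime p -> odd p -> 0 < delta -> (forall x, 0 <= x -> 0 < omega2 x) ->
    forall (u : unit_function R k p) (F0 : factor_list p (dimension u)),
    (complexity F0 <= d1 + d2 + d3)%N ->
    exists F F', [/\ finer k F F0 /\ finer k F' F, (complexity F <= c)%N,
      factor_rank_ge (quad_of F) (omega1 (complexity F)%:R),
      residual_cube_average (u := u) F' <= (1 / omega2 (complexity F)%:R) ^+ 8
      & factor_energy (u := u) F' - factor_energy (u := u) F <= delta ^+ 2].
  have [[[pr_p odd_p] [d0 o2]]|hn] :=
      pselect ((prime p /\ odd p) /\ (0 < delta /\ forall x, 0 <= x -> 0 < omega2 x)).
    (* The energy gap is the square of the norm of [f_sml], hence [delta^2]; the cube average is the
       eighth power of the U^3 norm, hence the exponent [8]. *)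
    have [c Hc] := strong_regularity k pr_p odd_p (fun d => omega1 d%:R)
      (d1 + d2 + d3) (exprn_gt0 2 d0)
      (fun d => exprn_gt0 8 (divr_gt0 ltr01 (o2 d%:R (ler0n R d)))).
    by exists c.
  by exists 0%N => pr_p odd_p d0 o2; case: hn.
exists (fun p k delta omega1 omega2 d1 d2 d3 =>
  sval (cid (bound p k delta omega1 omega2 d1 d2 d3))).
move=> k p delta omega1 omega2 n d1_0 d2_0 d3_0 f B0 _ pr_p odd_p delta0 _ o2 f01.
case: (cid _) => c /= /(_ pr_p odd_p delta0 o2) Hc.
pose u : unit_function R k p := UnitFunction f01.
pose F0 : factor_list p (dimension u) :=
  FactorList (linear_part B0) (symm_part B0) (skew_part B0).
have [|F [F' [[fin fin'] cF hr res en]]] := Hc u F0.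
  by rewrite /complexity /= !size_tuple.
pose E := fiber_mean (fiber F) f; pose E' := fiber_mean (fiber F') f.
have E01 X : 0 <= E X <= 1 := fiber_mean_bounds (fiber F) f01 X.
have E'01 X : 0 <= E' X <= 1 := fiber_mean_bounds (fiber F') f01 X.
exists (size (lins F)), (size (syms F)), (size (skews F)), (quad_of F).
exists E, (fun X => E' X - E X), (fun X => f X - E' X).
split; [|split; [|split; [|split; [|split; [|split; [|split; [|split; [|split]]]]]]]].
- apply: refines_of_finer => X Y /fiber_eq /fin h; exact/factor_map_eq_iff.
- by move=> X; ring.
- by [].
- apply: L2_norm_le; first exact: ltW.
  by rewrite (sum_sqr_fiber_mean_sub (fiber_finer fin')).
- apply: U3_norm_le => //; first by rewrite divr_ge0 // ltW // o2.
  exact: cube_average_ge0.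
- move=> X; have /andP[a0 a1] := E01 X; have /andP[b0 b1] := E'01 X.
  have /andP[c0 c1] := f01 X.
  by split; apply/andP; split; lra.
- by apply: leq_trans cF; rewrite /complexity -addnA leq_addr.
- by apply: leq_trans cF; rewrite /complexity addnAC leq_addl.
- by apply: leq_trans cF; rewrite /complexity leq_addl.
- exact: hr.
Qed.
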